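(* There exists a constant $c_2=c_2(N,\kappa,M)$, depending only on $N,\kappa,M$, such that the following holds. Suppose $\Lambda$ is a weakly admissible lattice for $(\mathcal{S},C)$, and let $Z_{\boldsymbol{Q}}$, $\mathbf{y}_1,\ldots,\mathbf{y}_n$ and $T$ be as described in the context. Then $$\left|\#(Z_{\boldsymbol{Q}}\cap\Lambda^* )-\frac{\mathrm{Vol}\, Z_{\boldsymbol{Q}}}{\zeta(N)\det\Lambda}\right|\leq c_2\left(\left(\frac{\overline{Q}}{\mu}+1\right)^{N-1}+\left(\frac{\overline{Q}}{\mu}+1\right)T(H)\right),$$ where $$H=N^{2N+2}\left(\overline{Q}+|\phi(\underline{\mathbf{y}})|\right)\left(\frac{1}{\mu}+\frac{1}{\overline{Q}}\right),$$ $\mu=\mu(\Lambda,Q_{max})$, and $|\phi(\underline{\mathbf{y}})|$ is the Euclidean norm of $(\overline{Q}\mathbf{y}_1/Q_1,\ldots,\overline{Q}\mathbf{y}_n/Q_n)\in\mathbb{R}^N$.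
   Context: Let $n\ge 1$ be an integer, $\boldsymbol{m}=(m_1,\ldots,m_n)$ a tuple of positive integers, $\boldsymbol{\beta}=(\beta_1,\ldots,\beta_n)\in(0,\infty)^n$, $\mathcal{S}=(\boldsymbol{m},\boldsymbol{\beta})$, $N:=\sum_i m_i$ (assumed $>1$), $t:=\sum_i\beta_i$. Elements of $\mathbb{R}^N=\mathbb{R}^{m_1}\times\cdots\times\mathbb{R}^{m_n}$ are written $\underline{\mathbf{x}}=(\mathbf{x}_1,\ldots,\mathbf{x}_n)$ with $\mathbf{x}_i\in\mathbb{R}^{m_i}$; $|\cdot|$ is the Euclidean norm. Put $\mathrm{Nm}_{\boldsymbol{\beta}}(\underline{\mathbf{x}}):=\prod_{i=1}^n|\mathbf{x}_i|^{\beta_i}$. Fix $I\subset\{1,\ldots,n\}$ and let $C=\{\underline{\mathbf{x}}\in\mathbb{R}^N:\mathbf{x}_i=\mathbf{0}\text{ for all }i\in I\}$. For $\Gamma\subset\mathbb{R}^N$ and $\rho>0$ set $\nu(\Gamma,\rho):=\inf\{\mathrm{Nm}_{\boldsymbol{\beta}}(\underline{\mathbf{x}})^{1/t}:\underline{\mathbf{x}}\in\Gamma\setminus C,\ |\underline{\mathbf{x}}|<\rho\}$, $\lambda_1(\Gamma):=\inf\{|\underline{\mathbf{x}}|:\underline{\mathbf{x}}\in\Gamma\setminus\{\mathbf{0}\}\}$, $\mu(\Gamma,\rho):=\min\{\lambda_1(\Gamma\cap C),\nu(\Gamma,\rho)\}$, with $\inf\emptyset=\infty$; if $\mu(\Gamma,\rho)=\infty$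 then $1/\mu(\Gamma,\rho)$ is interpreted as $0$. A lattice in $\mathbb{R}^N$ always has rank $N$. A lattice $\Lambda$ in $\mathbb{R}^N$ is weakly admissible for $(\mathcal{S},C)$ if $\nu(\Lambda,\rho)>0$ for all $\rho>0$. A point $\underline{\mathbf{x}}\in\Lambda$ is primitive if it is not of the form $k\underline{\mathbf{y}}$ with $\underline{\mathbf{y}}\in\Lambda$ and an integer $k>1$; $\Lambda^*$ is the set of primitive points of $\Lambda$. Let $\boldsymbol{Q}=(Q_1,\ldots,Q_n)\in(0,\infty)^n$, $\overline{Q}:=\left(\prod_{i=1}^nQ_i^{\beta_i}\right)^{1/t}$, $Q_{max}:=\max_iQ_i$, and assume $Q_i\le\overline{Q}$ for all $i\notin I$. For a positive integer $M$ and real $L\ge 0$, a set $S\subset\mathbb{R}^D$ ($D\geq 2$) is in Lip$(D,M,L)$ if there are $M$ maps $\phi_1,\ldots,\phi_M:[0,1]^{D-1}\to\mathbb{R}^D$ with $|\phi_i(\mathbf{x})-\phi_i(\mathbf{y})|\le L|\mathbf{x}-\mathbf{y}|$ for all $\mathbf{x},\mathbf{y}\in[0,1]^{D-1}$, whose images cover $S$. For $\kappa>0$ and a positive integer $M$ let $\mathcal{F}_{\kappa,M}$ be the family of sets $S\subset\mathbb{R}^N$ such that $\partial(AS)\in$ Lip$(N,M,\kappa\cdot\mathrm{diam}(AS))$ for all $A\in\mathrm{GL}_N(\mathbb{R})$, where $\partial$ is the topological boundary and $\mathrm{diam}$ the diameter. Fix $\kappa>0$ and a positive integer $M$. $Z_{\boldsymbol{Q}}\subset\mathbb{R}^N$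 denotes a set such that (1) $Z_{\boldsymbol{Q}}\in\mathcal{F}_{\kappa,M}$, and (2) for each $1\le i\le n$, $\pi_i(Z_{\boldsymbol{Q}})$ is contained in the closed Euclidean ball in $\mathbb{R}^{m_i}$ of radius $Q_i$ about a point $\mathbf{y}_i\in\mathbb{R}^{m_i}$, where $\pi_i(\underline{\mathbf{x}})=\mathbf{x}_i$; put $\underline{\mathbf{y}}=(\mathbf{y}_1,\ldots,\mathbf{y}_n)$. (Such a set is measurable.) $T:[0,\infty)\to[1,\infty)$ is a monotonic increasing function with $T(k)\ge\sum_{d\mid k}1$ for all positive integers $k$. $\zeta$ is the Riemann zeta function. *)

(* Defs.v *)
From HB Require Import structures.
From mathcomp Require Export all_boot all_order all_algebra.
From mathcomp Require Export all_classical all_reals all_analysis.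

Set Implicit Arguments.
Unset Strict Implicit.
Unset Printing Implicit Defensive.

Export Order.TTheory GRing.Theory Num.Theory.
Export numFieldNormedType.Exports.

Local Open Scope classical_set_scope.
Local Open Scope ring_scope.

(* Vectors are row vectors.  R^N = R^(m_1) x ... x R^(m_n) is
   'rV[R]_(\sum_i m i), and the block x_i is [submxrow x i]. *)

(* The library's norm on matrices is the sup norm (it induces the same
   topology), so the Euclidean norm is defined here. *)
Definition enorm (R : realType) (d : nat) (x : 'rV[R]_d) : R :=
  Num.sqrt (\sum_j x 0 j ^+ 2).

Definition total_weight (R : realType) (n : nat) (beta : 'I_n -> R) : R :=
  \sum_i beta i.

Definition Nm (R : realType) (n : nat) (m : 'I_n -> nat) (beta : 'I_n -> R)
    (x : 'rV[R]_(\sum_i m i)) : R :=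
  \prod_i (enorm (submxrow x i) `^ beta i).

Definition subspaceC (R : realType) (n : nat) (m : 'I_n -> nat)
    (I : {set 'I_n}) : set 'rV[R]_(\sum_i m i) :=
  [set x | forall i, i \in I -> submxrow x i = 0].

(* The infima live in \bar R, where [ereal_inf set0 = +oo]. *)
Definition nu (R : realType) (n : nat) (m : 'I_n -> nat) (beta : 'I_n -> R)
    (I : {set 'I_n}) (G : set 'rV[R]_(\sum_i m i)) (rho : R) : \bar R :=
  ereal_inf [set (Nm beta x `^ (total_weight beta)^-1)%:E
            | x in [set x | (G `\` subspaceC I) x /\ enorm x < rho]].

Definition lambda1 (R : realType) (d : nat) (G : set 'rV[R]_d) : \bar R :=
  ereal_inf [set (enorm x)%:E | x in G `\ 0].

Definition mu (R : realType) (n : nat) (m : 'I_n -> nat) (beta : 'I_n -> R)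
    (I : {set 'I_n}) (G : set 'rV[R]_(\sum_i m i)) (rho : R) : \bar R :=
  Order.min (lambda1 (G `&` subspaceC I)) (nu beta I G rho).

(* 1/mu as a real number; [inve +oo = 0], so it is 0 when mu = +oo. *)
Definition inv_mu (R : realType) (n : nat) (m : 'I_n -> nat)
    (beta : 'I_n -> R) (I : {set 'I_n}) (G : set 'rV[R]_(\sum_i m i))
    (rho : R) : R :=
  fine (mu beta I G rho)^-1%E.

(* The rows of B form a basis of the (full rank) lattice G. *)
Definition lattice_basis (R : realType) (d : nat) (B : 'M[R]_d)
    (G : set 'rV[R]_d) : Prop :=
  B \in unitmx /\ G = [set map_mx intr z *m B | z in [set: 'rV[int]_d]].

Definition is_lattice (R : realType) (d : nat) (G : set 'rV[R]_d) : Prop :=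
  exists B : 'M[R]_d, lattice_basis B G.

(* The value does not depend on the basis picked by [get]: two bases differ
   by an integer matrix of determinant 1 or -1. *)
Definition lattice_det (R : realType) (d : nat) (G : set 'rV[R]_d) : R :=
  `|\det (get [set B : 'M[R]_d | lattice_basis B G])|.

Definition weakly_admissible (R : realType) (n : nat) (m : 'I_n -> nat)
    (beta : 'I_n -> R) (I : {set 'I_n}) (G : set 'rV[R]_(\sum_i m i)) : Prop :=
  forall rho : R, 0 < rho -> (0 < nu beta I G rho)%E.

Definition primitive (R : realType) (d : nat) (G : set 'rV[R]_d) :
    set 'rV[R]_d :=
  [set x | G x /\
    ~ exists (k : nat) (y : 'rV[R]_d), [/\ (1 < k)%N, G y & x = k%:R *: y]].

Definition Qbar (R : realType) (n : nat) (beta Q : 'I_n -> R) : R :=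
  (\prod_i (Q i `^ beta i)) `^ (total_weight beta)^-1.

Definition Qmax (R : realType) (n : nat) (Q : 'I_n -> R) : R :=
  \big[Order.max/0]_i Q i.

Definition phi_scale (R : realType) (n : nat) (m : 'I_n -> nat)
    (beta Q : 'I_n -> R) (y : forall i, 'rV[R]_(m i)) : 'rV[R]_(\sum_i m i) :=
  \mxrow_i ((Qbar beta Q / Q i) *: y i).

Definition unit_cube (R : realType) (d : nat) : set 'rV[R]_d :=
  [set x | forall j, 0 <= x 0 j <= 1].

Definition Lip (R : realType) (D M : nat) (L : R) (S : set 'rV[R]_D) : Prop :=
  exists phi : 'I_M -> 'rV[R]_D.-1 -> 'rV[R]_D,
    (forall i x y, @unit_cube R D.-1 x -> @unit_cube R D.-1 y ->
       enorm (phi i x - phi i y) <= L * enorm (x - y)) /\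
    S `<=` \bigcup_(i : 'I_M) (phi i @` @unit_cube R D.-1).

Definition bdry (T : topologicalType) (S : set T) : set T :=
  closure S `\` interior S.

(* Supremum in \bar R; 0 is included so that the empty set has diameter 0. *)
Definition diam (R : realType) (d : nat) (S : set 'rV[R]_d) : \bar R :=
  ereal_sup (0%E |` [set (enorm (x - y))%:E | x in S & y in S]).

(* The Lipschitz constant is a real number, hence the diameter of every AS is
   required to be finite. *)
Definition lip_family (R : realType) (d : nat) (kappa : R) (M : nat)
    (S : set 'rV[R]_d) : Prop :=
  forall A : 'M[R]_d, A \in unitmx ->
    let AS := [set x *m A | x in S] in
    diam AS \is a fin_num /\ Lip M (kappa * fine (diam AS)) (bdry AS).

Definition box (R : realType) (d : nat) (a b : 'rV[R]_d) : set 'rV[R]_d :=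
  [set x | forall j, a 0 j <= x 0 j <= b 0 j].

(* d-dimensional Lebesgue (outer) measure.  The sets to which it is applied
   are Lebesgue measurable, but in general not Borel. *)
Definition vol (R : realType) (d : nat) (S : set 'rV[R]_d) : \bar R :=
  ereal_inf [set (\sum_(0 <= k <oo) (\prod_j (ab.2 k 0 j - ab.1 k 0 j))%:E)%E
            | ab in [set ab : (nat -> 'rV[R]_d) * (nat -> 'rV[R]_d) |
                (forall k j, ab.1 k 0 j <= ab.2 k 0 j) /\
                S `<=` \bigcup_k box (ab.1 k) (ab.2 k)]].

(* Riemann zeta function at a real s > 1. *)
Definition zeta (R : realType) (s : R) : R := limn (series (riemannR s)).

(* Main.v *)
(* Scaling the blocks by Qbar / Q_i leaves Nm unchanged, so every nonzero point
   of the scaled lattice has norm at least lam := (1/mu + 1/Qbar)^-1.  Such a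
   lattice has a basis whose coordinate functionals have norm at most N!/lam.
   In these coordinates the lattice is Z^N and Z becomes a set W of diameter
   O(X), where X := Qbar/mu + 1; the Lipschitz hypothesis holds for all linear
   images of Z, hence for W/k.  So #(W \cap k Z^N) differs from vol(W)/k^N by the
   number of unit cubes meeting the boundary of W/k, which is O((X/k)^(N-1)) for
   k <= X.  Moebius inversion over k <= X gives the main term.  For k > X each
   W \cap k Z^N has O(1) points, and such a k matters only if it divides a nonzero
   coordinate of a point of W; as each coordinate takes O(X) values, all of size
   at most H, there are O(X T(H)) such k. *)

Require Import Defs.
From mathcomp Require Import all_boot all_order all_algebra.
From mathcomp Require Import finmap.
From mathcomp Require Import all_classical all_reals all_analysis.
From mathcomp Require Import ring lra zify.

Set Implicit Arguments.
Unset Strict Implicit.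
Unset Printing Implicit Defensive.

Import Order.TTheory GRing.Theory Num.Theory.
Import numFieldNormedType.Exports.

Local Open Scope classical_set_scope.
Local Open Scope ring_scope.

(** * Volume *)

(** [vol] is an outer measure built from boxes. Three facts about it carry the argument: countable
    subadditivity, the factor |det| under linear maps, and the comparison with counts of unit cubes.
    The number of integer points of a set and its volume both lie between the number of cubes inside
    the set and that number plus the number of cubes meeting its boundary; the lower bound for the
    volume comes from compactness.

    The constant may depend on N, kappa and M alone. The danger lies in the change of coordinates to
    Z^N, which is controlled because the basis is built from almost minimal vectors of successive
    projections. The position of Z enters through H and nowhere else.

    The Moebius sum is cut at K = floor X and compared with 1/zeta(N) by a finite identity in place
    of a product of series. This costs a factor 1 + 1/2 + ... + 1/K, which also appears in the
    summed boundary error when N = 2. Both are absorbed by T(H), which is at least logarithmic in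
    X. *)

Definition boxvol (R : realType) (d : nat) (a b : 'rV[R]_d) : R :=
  \prod_j (b 0 j - a 0 j).

Section Volume.
Variables (R : realType) (d : nat).
Implicit Types (S : set 'rV[R]_d) (a b : 'rV[R]_d).

Lemma boxvol_ge0 a b : (forall j, a 0 j <= b 0 j) -> 0 <= boxvol a b.
Proof. by move=> ab; apply: prodr_ge0 => j _; rewrite subr_ge0. Qed.

Lemma vol_ge0 S : (0 <= vol S)%E.
Proof.
apply: le_ereal_inf_tmp => _ [[a b] /= [ab _] <-].
by apply: nneseries_ge0 => k _ _; rewrite lee_fin boxvol_ge0.
Qed.

Lemma vol_le_series S (a b : nat -> 'rV[R]_d) :
  (forall k j, a k 0 j <= b k 0 j) -> S `<=` \bigcup_k box (a k) (b k) ->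
  (vol S <= \sum_(0 <= k <oo) (boxvol (a k) (b k))%:E)%E.
Proof. by move=> ab SU; apply: ereal_inf_lbound; exists (a, b). Qed.

Lemma vol_cover S (e : R) : 0 < e -> vol S \is a fin_num ->
  exists ab : (nat -> 'rV[R]_d) * (nat -> 'rV[R]_d),
  [/\ forall k j, ab.1 k 0 j <= ab.2 k 0 j,
      S `<=` \bigcup_k box (ab.1 k) (ab.2 k) &
      (\sum_(0 <= k <oo) (boxvol (ab.1 k) (ab.2 k))%:E <= vol S + e%:E)%E].
Proof.
move=> e0 fS; have [_ [ab [ab1 ab2] <-] abe] := lb_ereal_inf_adherent e0 fS.
by exists ab; split=> //; exact: ltW.
Qed.

(** Each [F n] gets a cover by boxes that exceeds its volume by at most e / 2^(n+1); a bijection of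
    [nat] with [nat * nat] turns the double family into a single cover. If some [F n] has infinite
    volume there is nothing to prove. *)
Lemma vol_bigcup_le S (F : nat -> set 'rV[R]_d) :
  S `<=` \bigcup_k F k -> (vol S <= \sum_(0 <= k <oo) vol (F k))%E.
Proof.
move=> SF; have [[i ioo]|] := pselect (exists i, vol (F i) = +oo%E).
  rewrite (eseries_pinfty _ _ ioo) ?leey// => n _.
  by rewrite -ltNye (lt_le_trans _ (vol_ge0 _)).
rewrite -forallNE => Foo.
suff add2e (e : {posnum R}) : (vol S <= \sum_(0 <= k <oo) vol (F k) + e%:num%:E)%E.
  by apply/lee_addgt0Pr => _/posnumP[].
rewrite (le_trans _ (epsilon_trick _ _ _))//; last by move=> n; exact: vol_ge0.
have /choice[G PG] n : exists ab : (nat -> 'rV[R]_d) * (nat -> 'rV[R]_d),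
  [/\ forall k j, ab.1 k 0 j <= ab.2 k 0 j,
      F n `<=` \bigcup_k box (ab.1 k) (ab.2 k) &
      (\sum_(0 <= k <oo) (boxvol (ab.1 k) (ab.2 k))%:E
        <= vol (F n) + (e%:num / (2 ^ n.+1)%:R)%:E)%E].
  apply: vol_cover => //; rewrite fin_real// (lt_le_trans _ (vol_ge0 _))//=.
  by rewrite ltey; apply/eqP/Foo.
pose v (p : nat * nat) := (boxvol ((G p.1).1 p.2) ((G p.1).2 p.2))%:E.
have v0 p : (0 <= v p)%E.
  by rewrite lee_fin boxvol_ge0// => j; have [+ _ _] := PG p.1; apply.
apply: (@le_trans _ _ (\esum_(i in setT) v i)).
  have /card_esym/ppcard_eqP[f] := card_nat2.
  have := @vol_le_series S (fun n => (G (f n).1).1 (f n).2)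
                           (fun n => (G (f n).1).2 (f n).2).
  rewrite [X in (_ -> _ -> (_ <= X)%E) -> _](_ : _ = \esum_(i in setT) v i)%E.
    apply=> [k j|x Sx]; first by have [+ _ _] := PG (f k).1; apply.
    have [n _ Fx] := SF _ Sx; have [_ + _] := PG n => /(_ _ Fx)[k _ bx].
    exists (f^-1%FUN (n, k)) => //=.
    by rewrite invK ?inE.
  rewrite -[RHS](_ : \esum_(i in f @` xpredT) v i = _)%E; last first.
    by rewrite [fun=> _]set_true image_eq.
  by rewrite esum_pred_image// [fun=> _]set_true.
rewrite (_ : esum _ _ = \sum_(0 <= i <oo) \sum_(0 <= j <oo) v (i, j))%E; last first.
  rewrite nneseries_esumT; last by move=> n; apply: nneseries_ge0.
  rewrite (eq_esum (fun i _ => nneseries_esumT (fun j => v0 (i, j)))).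
  rewrite (@esum_esum _ _ _ _ _ (fun i j => v (i, j)))//.
  rewrite (_ : setT `*`` _ = setT); last by apply/seteqP; split.
  by apply: eq_esum => -[].
apply: lee_lim.
- by apply: is_cvg_nneseries => n _ _; apply: nneseries_ge0.
- apply: is_cvg_nneseries => n _ _; apply: adde_ge0 => //; exact: vol_ge0.
- by near=> n; apply: lee_sum => i _; have [_ _] := PG i.
Unshelve. all: by end_near. Qed.

Lemma le_vol S S' : S `<=` S' -> (vol S <= vol S')%E.
Proof.
move=> SS'; apply: le_ereal_inf => _ [ab [ab1 ab2] <-].
by exists ab => //; split=> //; apply: subset_trans ab2.
Qed.

(* In dimension 0 every box has volume 1, hence [vol] is constantly +oo. *)
Hypothesis d0 : (0 < d)%N.

Lemma boxvolxx a : boxvol a a = 0.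
Proof.
rewrite /boxvol; under eq_bigr do rewrite subrr.
by rewrite prodr_const card_ord expr0n eqn0Ngt d0.
Qed.

Lemma vol_box a b : (forall j, a 0 j <= b 0 j) -> (vol (box a b) <= (boxvol a b)%:E)%E.
Proof.
move=> ab.
(* The cover by one box is padded with degenerate boxes, of volume 0 because the dimension is
   positive. *)
apply: le_trans (@vol_le_series _ (fun k => a) (fun k => if k is 0%N then b else a) _ _) _.
- by move=> [|k].
- by move=> x xab; exists 0%N.
- rewrite (@nneseries_split _ _ 0 1)//; last by move=> [|k] _; rewrite lee_fin boxvol_ge0.
  rewrite big_nat1 add0n eseries0 ?adde0// => -[|k]// _ _.
  by rewrite boxvolxx.
Qed.

Lemma vol_set0 : vol (@set0 'rV[R]_d) = 0%E.
Proof.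
apply/eqP; rewrite eq_le vol_ge0 andbT.
by apply: le_trans (le_vol (@sub0set _ (box 0 0))) _; rewrite (le_trans (vol_box _))// boxvolxx.
Qed.

Lemma vol_bigcup_fin S n (F : 'I_n -> set 'rV[R]_d) :
  S `<=` \bigcup_i F i -> (vol S <= \sum_i vol (F i))%E.
Proof.
move=> SF.
have := @vol_bigcup_le S (fun k => if insub k is Some i then F i else set0).
rewrite (@nneseries_split _ _ 0 n); last by move=> *; exact: vol_ge0.
rewrite add0n [X in (_ + X)%E]eseries0 ?adde0; last first.
  by move=> k nk _; rewrite insubF ?vol_set0// ltnNge nk.
rewrite big_mkord => h; apply: le_trans (h _) _.
  by move=> x /SF[i _ Fx]; exists (val i) => //=; rewrite valK.
by apply: lee_sum => i _; rewrite valK.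
Qed.

End Volume.

(** The identity with row [r] replaced by [v]: it scales coordinate [r] by [v 0 r] and shears the
    others by multiples of x_r. One such factor performs a whole elimination step, and its effect on
    a box can be estimated directly. *)
Definition row_repl (R : realType) (d : nat) (r : 'I_d) (v : 'rV[R]_d) : 'M[R]_d :=
  \matrix_(i, j) if i == r then v 0 j else (i == j)%:R.

(** * Volume under a matrix with a single nontrivial row *)

Section Shear.
Variables (R : realType) (d : nat).
Implicit Types (S : set 'rV[R]_d) (a b v : 'rV[R]_d) (A : 'M[R]_d).

Lemma mul_row_repl (x : 'rV[R]_d) (r : 'I_d) v j :
  (x *m row_repl r v) 0 j = x 0 r * v 0 j + (if j == r then 0 else x 0 j).
Proof.
rewrite mxE (bigD1 r)//= mxE eqxx; congr (_ + _).
transitivity (\sum_(i | i != r) (if i == j then x 0 i else 0)).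
  apply: eq_bigr => i /negPf ir; rewrite mxE ir.
  by case: eqP => _; rewrite ?mulr1 ?mulr0.
case: (eqVneq j r) => [->|jr]; first by rewrite big1// => i /negPf ->.
by rewrite (bigD1 j)//= eqxx big1 ?addr0// => i /andP[_ /negPf ->].
Qed.

Lemma det_row_repl (r : 'I_d) v : \det (row_repl r v) = v 0 r.
Proof.
rewrite (expand_det_row _ r).
(* The cofactors along row [r] do not see that row, so they are those of the identity matrix. *)
have E j : cofactor (row_repl r v) r j = (\adj (1%:M : 'M[R]_d)) j r.
  rewrite [RHS]mxE /cofactor; congr (_ * \det _).
  by apply/matrixP => i k; rewrite !mxE eq_sym (negPf (neq_lift _ _)).
have adj1 : \adj (1%:M : 'M[R]_d) = 1%:M by rewrite -[LHS]mul1mx mul_mx_adj det1.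
rewrite (bigD1 r)//= big1 ?addr0 => [|j jr]; rewrite E adj1 !mxE ?eqxx ?mulr1//.
by rewrite (negPf jr) mulr0.
Qed.

Hypothesis d0 : (0 < d)%N.

(* Cut the box into [n.+1] slabs orthogonal to the axis [r]: the image of a
   slab is contained in a box that exceeds it by [O(1 / n)] in each direction. *)
Lemma vol_slabs (a b v : 'rV[R]_d) (r : 'I_d) (n : nat) :
  (forall j, a 0 j <= b 0 j) ->
  (vol [set (x *m row_repl r v)%R | x in box a b] <=
   (`|v 0 r| * (b 0 r - a 0 r) *
    \prod_(j | j != r) (b 0 j - a 0 j +
       2 * `|v 0 j| * (b 0 r - a 0 r) * n.+1%:R^-1))%:E)%E.
Proof.
move=> ab; set h : R := n.+1%:R^-1; set w := b 0 r - a 0 r.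
have h0 : 0 < h by rewrite invr_gt0.
have h0' := ltW h0.
have w0 : 0 <= w by rewrite subr_ge0.
pose t (l : nat) : R := a 0 r + w * (l%:R * h).
(* On slab [l], x_r = t l + s with 0 <= s <= w h. Coordinate [r] of the image is t l v_r + s v_r,
   where v_r has either sign, whence [min] and [max]; any other coordinate is x_j + t l v_j + s v_j,
   with |s v_j| <= |v_j| w h. *)
pose lo l : 'rV[R]_d := \row_j (t l * v 0 j +
  if j == r then Num.min 0 (v 0 r * (w * h)) else a 0 j - `|v 0 j| * (w * h)).
pose hi l : 'rV[R]_d := \row_j (t l * v 0 j +
  if j == r then Num.max 0 (v 0 r * (w * h)) else b 0 j + `|v 0 j| * (w * h)).
have lohi l j : hi l 0 j - lo l 0 j =
    if j == r then `|v 0 r| * w * h else b 0 j - a 0 j + 2 * `|v 0 j| * w * h.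
  rewrite !mxE; case: ifP => _; last by ring.
  have [v0|v0] := leP 0 (v 0 r).
    by rewrite ger0_norm// min_l ?max_r ?mulr_ge0//; ring.
  have q0 : v 0 r * (w * h) <= 0 by rewrite mulr_le0_ge0 ?mulr_ge0// ltW.
  by rewrite ltr0_norm// min_r// max_l//; ring.
have lehi l j : lo l 0 j <= hi l 0 j.
  rewrite -subr_ge0 lohi; case: ifP => _; first by rewrite !mulr_ge0.
  by rewrite addr_ge0 ?subr_ge0// !mulr_ge0.
apply: le_trans (@vol_bigcup_fin _ _ d0 _ n.+1 (fun l => box (lo l) (hi l)) _) _.
  move=> _ [x xab <-].
  have [l /andP[tl1 tl2]] : exists l : 'I_n.+1, t l <= x 0 r <= t l + w * h.
    have /andP[ax xb] := xab r.
    have [w00|wN0] := eqVneq w 0.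
      exists ord0; rewrite /t w00; move: w00; rewrite /w; move: ax xb => /=; lra.
    have wp : 0 < w by rewrite lt_neqAle eq_sym wN0.
    pose u := (x 0 r - a 0 r) / w * n.+1%:R.
    have u0 : 0 <= u by rewrite !mulr_ge0// ?subr_ge0// invr_ge0.
    have xE : x 0 r = a 0 r + w * (u * h).
      by rewrite /u /h mulfK ?pnatr_eq0// mulrCA divff// mulr1; ring.
    have un : u <= n.+1%:R.
      by rewrite /u ler_piMl// ler_pdivrMr// mul1r /w lerB.
    (* The right end of the interval has index [n.+1] and is put into the last slab. *)
    have [u1|u1] := leP n.+1%:R u.
      exists ord_max; have uE : u = n.+1%:R by apply/eqP; rewrite eq_le un.
      have nh : n%:R * h + h = 1.
        by rewrite -[X in _ + X]mul1r -mulrDl natr1 mulfV// pnatr_eq0.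
      have E : w * 1 = w * (n%:R * h) + w * h by rewrite -mulrDr nh.
      rewrite /t xE /= uE mulfV ?pnatr_eq0// E addrA.
      by rewrite lerDl lexx mulr_ge0.
    have un' : (Num.truncn u < n.+1)%N by rewrite truncn_lt_nat.
    exists (Ordinal un'); rewrite /t xE /=.
    have /andP[v1 v2] := truncn_itv u0.
    rewrite -addrA -mulrDr !lerD2l !ler_pM2l// ler_pM2r// v1/=.
    by rewrite -[X in _ + X]mul1r -mulrDl natr1 ler_pM2r// ltW.
  exists l => // j; rewrite mul_row_repl !mxE.
  have [s xE [s0 s1]] : exists2 s, x 0 r = t l + s & 0 <= s /\ s <= w * h.
    by exists (x 0 r - t l); [ring|rewrite subr_ge0 lerBlDl].
  rewrite xE; move: (t l) => tl.
  rewrite (mulrDl tl s) -!(addrA (tl * _)) !lerD2l.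
  case: ifP => [/eqP->|_].
    rewrite addr0 ge_min le_max.
    have [v0|v0] := leP 0 (v 0 r).
      by rewrite mulr_ge0//= mulrC ler_wpM2l ?orbT.
    by rewrite mulr_ge0_le0 ?(ltW v0)//= andbT mulrC ler_wnM2l ?orbT ?(ltW v0).
  have /andP[ax xb] := xab j.
  have : `|s * v 0 j| <= `|v 0 j| * (w * h).
    by rewrite normrM mulrC ler_wpM2l// ger0_norm.
  rewrite ler_norml => /andP[q1 q2].
  by apply/andP; split; lra.
apply: (@le_trans _ _ (\sum_(l < n.+1) (`|v 0 r| * w * h *
    \prod_(j | j != r) (b 0 j - a 0 j + 2 * `|v 0 j| * w * h))%:E)%E).
  apply: lee_sum => l _; apply: le_trans (vol_box d0 _) _ => //.
  rewrite lee_fin /boxvol (bigD1 r)//= lohi eqxx.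
  by rewrite [X in _ * X <= _](eq_bigr _ (fun j jr => etrans (lohi l j) (ifN_eq _ _ jr))).
rewrite sumEFin lee_fin sumr_const card_ord -[X in X <= _]mulr_natl.
have nh : n.+1%:R * h = 1 by rewrite mulfV// pnatr_eq0.
by rewrite mulrA -(mulrC h) mulrA nh mul1r.
Qed.

(** The slab bound is a polynomial in 1 / (n + 1); by continuity it tends to its value at 0, which
    is the claimed volume. *)
Lemma vol_box_row_repl (a b v : 'rV[R]_d) (r : 'I_d) :
  (forall j, a 0 j <= b 0 j) ->
  (vol [set (x *m row_repl r v)%R | x in box a b] <= (`|v 0 r| * boxvol a b)%:E)%E.
Proof.
move=> ab; have := vol_slabs v r ^~ ab.
set V := vol _; set w := b 0 r - a 0 r => Vle.
pose p : {poly R} := (`|v 0 r| * w)%:P *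
  \prod_(j | j != r) ((b 0 j - a 0 j)%:P + (2 * `|v 0 j| * w)%:P * 'X).
have pE u : p.[u] = `|v 0 r| * w *
    \prod_(j | j != r) (b 0 j - a 0 j + 2 * `|v 0 j| * w * u).
  rewrite /p hornerM hornerC horner_prod; congr (_ * _); apply: eq_bigr => j _.
  by rewrite hornerD hornerM !hornerC hornerX.
have fV : V \is a fin_num.
  by rewrite ge0_fin_numE ?vol_ge0// (le_lt_trans (Vle 0%N)) ?ltry.
rewrite -(fineK fV) lee_fin.
have -> : `|v 0 r| * boxvol a b = p.[0].
  rewrite pE /boxvol (bigD1 r)//= mulrA; congr (_ * _); apply: eq_bigr => j _.
  by rewrite mulr0 addr0.
have : p.[harmonic n] @[n --> \oo] --> p.[0].
  by apply: continuous_cvg; [exact: continuous_horner|exact: cvg_harmonic].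
move/cvgr_to_ge; apply; apply: nearW => n.
by rewrite -lee_fin fineK// pE; exact: Vle.
Qed.

Lemma vol_row_repl S v (r : 'I_d) : v 0 r != 0 ->
  (vol [set (x *m row_repl r v)%R | x in S] <= `|v 0 r|%:E * vol S)%E.
Proof.
move=> vr0; have vr : 0 < `|v 0 r| by rewrite normr_gt0.
have [Soo|fS] := eqVneq (vol S) +oo%E.
  by rewrite Soo gt0_muley ?lte_fin// leey.
have {}fS : vol S \is a fin_num by rewrite ge0_fin_numE ?vol_ge0// ltey.
apply/lee_addgt0Pr => e e0.
have [[a b] /= [ab Sab le]] := vol_cover (divr_gt0 e0 vr) fS.
apply: le_trans (@vol_bigcup_le _ _ _ (fun k => [set x *m row_repl r v | x in box (a k) (b k)]) _) _.
  by move=> _ [x /Sab[k _ bx] <-]; exists k => //; exists x.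
apply: (@le_trans _ _ (\sum_(0 <= k <oo) (`|v 0 r|%:E * (boxvol (a k) (b k))%:E)%E)%E).
  apply: lee_nneseries => k *; first exact: vol_ge0.
  by rewrite -EFinM; exact: vol_box_row_repl.
rewrite nneseriesZl; last by move=> k _; rewrite lee_fin boxvol_ge0.
have -> : (`|v 0 r|%:E * vol S + e%:E =
           `|v 0 r|%:E * (vol S + (e / `|v 0 r|)%:E))%E.
  rewrite ge0_muleDr ?vol_ge0// ?lee_fin; last by rewrite ltW// divr_gt0.
  by rewrite -EFinM mulrC divfK// gt_eqF.
by rewrite lee_pmul2l// lte_fin.
Qed.
End Shear.

(** * Invertible linear maps multiply the volume by |det| *)

Section LinearVolume.
Variables (R : realType) (d : nat).
Implicit Types (S : set 'rV[R]_d) (v : 'rV[R]_d) (A B : 'M[R]_d).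

Lemma row_row_repl (r i : 'I_d) v :
  row i (row_repl r v) = if i == r then v else row i 1%:M.
Proof. by apply/rowP => j; rewrite !mxE; case: ifP => _ //; rewrite !mxE. Qed.

(* Gaussian elimination. *)
Lemma row_repl_ind (P : 'M[R]_d -> Prop) :
  P 1%:M -> (forall A B, P A -> P B -> P (A *m B)) ->
  (forall r v, v 0 r != 0 -> P (row_repl r v)) ->
  forall A, A \in unitmx -> P A.
Proof.
move=> P1 PM PG.
(* The first [r] rows already agree with the identity; [k] rows remain. *)
suff H k : forall r, (k + r = d)%N -> forall A, A \in unitmx ->
    (forall i : 'I_d, (i < r)%N -> row i A = row i 1%:M) -> P A.
  by move=> A uA; apply: (H d 0%N) => //; rewrite addn0.
elim: k => [|k IH] r krd A uA Ar.
  suff -> : A = 1%:M by [].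
  by apply/row_matrixP => i; apply: Ar; rewrite -[r]add0n krd.
have rd : (r < d)%N by rewrite -krd addSn ltnS leq_addl.
pose r' := Ordinal rd.
(* Cancelling on the right the factor whose row [r'] is that of [B] turns this row into a unit
   vector and keeps the earlier rows. *)
have pivot B : B \in unitmx -> (forall i : 'I_d, (i < r)%N -> row i B = row i 1%:M) ->
    B r' r' != 0 -> P B.
  move=> uB Br Brr; pose G := row_repl r' (row r' B).
  have uG : G \in unitmx by rewrite unitmxE det_row_repl mxE unitfE.
  rewrite -(mulmxKV uG B); apply: PM; last by apply: PG; rewrite mxE.
  apply: (IH r.+1); first by rewrite addnS.
    by rewrite unitmx_mul uB unitmx_inv.
  move=> i; rewrite ltnS leq_eqVlt => ir.
  rewrite row_mul (_ : row i B = row i G); first by rewrite -row_mul mulmxV.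
  rewrite row_row_repl; case: eqP => [->//|/eqP ir']; apply: Br.
  by case/orP: ir => // /eqP ir; case/eqP: ir'; apply/val_inj.
have [Arr|] := eqVneq (A r' r') 0; last exact: pivot.
(* If row [r] vanished on and to the right of the diagonal, it would be a combination of the earlier
   rows, which are unit vectors; [u] is the resulting linear relation among the rows. *)
have [j rj Arj] : exists2 j : 'I_d, (r < j)%N & A r' j != 0.
  apply: contrapT => nj.
  have A0 (j : 'I_d) : (r <= j)%N -> A r' j = 0.
    rewrite leq_eqVlt => /orP[/eqP rj|rj].
      by rewrite (_ : j = r')//; apply/val_inj.
    by apply: contrapT => /eqP Aj; apply: nj; exists j.
  pose u : 'rV[R]_d := \row_i (if (i < r)%N then - A r' i else (i == r')%:R).
  have uA0 : u *m A = 0.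
    apply/rowP => l; rewrite !mxE (bigD1 r')//= !mxE ltnn eqxx mul1r.
    rewrite (eq_bigr (fun i : 'I_d => if i == l then if (i < r)%N then - A r' i else 0 else 0)).
      rewrite -!big_mkcondr/=.
      have [lr|lr] := ltnP l r.
        rewrite (big_pred1 l) ?subrr// => i /=.
        case: (eqVneq i l) => [->|]; last by rewrite andbF.
        by rewrite lr !andbT; apply/eqP => lr'; rewrite lr' ltnn in lr.
      rewrite big_pred0 ?addr0 ?A0// => i.
      by case: (eqVneq i l) => [->|]; rewrite ?andbF//= ltnNge lr andbF.
    move=> i ir; rewrite mxE (negPf ir).
    case: ifP => [lir|_]; last by rewrite mul0r; case: ifP.
    have /rowP/(_ l) := Ar _ lir; rewrite !mxE => ->.
    by case: eqP => _; rewrite ?mulr1 ?mulr0.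
  have u0 : u = 0 by rewrite -(mulmxK uA u) uA0 mul0mx.
  have /rowP/(_ r') := u0; rewrite !mxE ltnn eqxx => /eqP.
  by rewrite oner_eq0.
have jr' : (r' == j) = false by apply/eqP => /(congr1 val)/= E; rewrite E ltnn in rj.
have r'j : (j == r') = false by rewrite eq_sym.
(* [G c] adds [c] times column [j] to column [r']. It makes the pivot nonzero, and its inverse
   [G (- c)] is again an admissible factor. *)
pose G (c : R) : 'M[R]_d := row_repl j (delta_mx 0 j + c *: delta_mx 0 r').
have GE c (x : 'rV[R]_d) l : (x *m G c) 0 l = x 0 l + c * x 0 j * (l == r')%:R.
  rewrite mul_row_repl !mxE !eqxx/=.
  case: (eqVneq l j) => [->|_]; rewrite ?eqxx ?r'j ?mulr1n ?mulr0n; first by ring.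
  by case: (l == r'); rewrite ?mulr1n ?mulr0n; ring.
have GK : G 1 *m G (- 1) = 1%:M.
  apply/row_matrixP => i; rewrite row_mul; apply/rowP => l.
  rewrite GE !mxE; case: (eqVneq i j) => [->|ij]; last first.
    by rewrite /= ?(negPf ij) /=; ring.
  rewrite !eqxx /= r'j [j == l]eq_sym.
  by case: (l == j); case: (l == r'); rewrite ?mulr1n ?mulr0n; ring.
rewrite -(mulmx1 A) -GK mulmxA; apply: PM; last first.
  by apply: PG; rewrite !mxE !eqxx /= r'j mulr0 addr0 oner_eq0.
apply: pivot.
- rewrite unitmx_mul uA unitmxE det_row_repl !mxE !eqxx /= r'j mulr0 addr0.
  exact: unitr1.
- move=> i ir; rewrite row_mul (Ar _ ir); apply/rowP => l.
  rewrite GE !mxE (_ : (i == j) = false) ?mulr0 ?mul0r ?addr0//.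
  by apply/eqP => ij; move: rj; rewrite -ij ltnNge ltnW.
- have := GE 1 (row r' A) r'; rewrite -row_mul !mxE => ->.
  by rewrite Arr eqxx add0r mul1r mulr1.
Qed.

Hypothesis d0 : (0 < d)%N.

Lemma vol_mulmx_le A S : A \in unitmx ->
  (vol [set (x *m A)%R | x in S] <= `|\det A|%:E * vol S)%E.
Proof.
move=> uA; move: A uA S; apply: row_repl_ind => [S|A B hA hB S|r v vr S].
- rewrite det1 normr1 mul1e; apply: le_vol => _ [x Sx <-].
  by rewrite mulmx1.
- rewrite det_mulmx normrM EFinM (muleC `|\det A|%:E) -muleA.
  apply: le_trans (lee_wpmul2l _ (hA S)); rewrite ?lee_fin//.
  apply: le_trans (hB _); apply: le_vol => _ [x Sx <-].
  by exists (x *m A); [exists x|rewrite mulmxA].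
- by rewrite det_row_repl; exact: vol_row_repl.
Qed.

(** The upper bound for the inverse matrix is the lower bound for [A]. *)
Lemma vol_mulmx A S : A \in unitmx ->
  vol [set (x *m A)%R | x in S] = (`|\det A|%:E * vol S)%E.
Proof.
move=> uA; apply/eqP; rewrite eq_le vol_mulmx_le//=.
have uA' : invmx A \in unitmx by rewrite unitmx_inv.
have dA : 0 < `|\det A| by rewrite normr_gt0 -unitfE -unitmxE.
have := @vol_mulmx_le (invmx A) [set (x *m A)%R | x in S] uA'.
rewrite (_ : [set y *m invmx A | y in [set x *m A | x in S]] = S); last first.
  apply/seteqP; split=> [_ [_ [x Sx <-] <-]|x Sx]; first by rewrite mulmxK.
  by exists (x *m A); [exists x|rewrite mulmxK].
rewrite det_inv normfV => /(lee_wpmul2l (ltW dA : 0%R <= `|\det A|%:E)%E).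
by rewrite muleA -EFinM mulfV ?gt_eqF// mul1e.
Qed.
End LinearVolume.

(** * Integer points *)

Definition zr (R : realType) (d : nat) (z : 'rV[int]_d) : 'rV[R]_d := map_mx intr z.

Definition ucell (R : realType) (d : nat) (z : 'rV[int]_d) : set 'rV[R]_d :=
  box (zr R z) (zr R z + const_mx 1).

Lemma size_le_sum_filter (T : eqType) (I : finType) (t : seq T) (P : I -> pred T) :
  {in t, forall z, exists i, P i z} ->
  (size t <= \sum_i size [seq z <- t | P i z])%N.
Proof.
move=> tP; rewrite -sum1_size.
under [X in (_ <= X)%N]eq_bigr do rewrite size_filter -sum1_count big_mkcond/=.
rewrite exchange_big/= big_seq [in X in (_ <= X)%N]big_seq; apply: leq_sum => z /tP[i Pz].
by rewrite (bigD1 i)//= Pz.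
Qed.

Lemma rV_neq0 (V : nmodType) (d : nat) (z : 'rV[V]_d) :
  z != 0 -> exists j, z 0 j != 0.
Proof.
move=> z0; apply: contrapT => nz; case/eqP: z0; apply/rowP => j; rewrite mxE.
by apply/eqP; apply: contrapT => zj; apply: nz; exists j; apply/negP.
Qed.

Section IntegerPoints.
Variables (R : realType) (d : nat).
Implicit Types (a b : 'rV[R]_d) (W : set 'rV[R]_d).

(** The offsets of the coordinates from the ceilings of those of [a] embed the points into a product
    of finite ranges, the one at [j] having [truncn (b 0 j - a 0 j) + 1] elements. *)
Lemma size_int_box a b (t : seq 'rV[int]_d) :
  (forall j, a 0 j <= b 0 j) -> uniq t -> {in t, forall u, box a b (zr R u)} ->
  (size t)%:R <= \prod_j (b 0 j - a 0 j + 1).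
Proof.
move=> ab ut tab.
pose n (j : 'I_d) := (Num.truncn (b 0 j - a 0 j)).+1.
(* A common bound for the ranges, so that one ordinal type serves all coordinates. *)
pose K := (\sum_j n j)%N.
have nK j : (n j <= K)%N by rewrite /K (bigD1 j)//= leq_addr.
pose g (u : 'rV[int]_d) : {ffun 'I_d -> 'I_K.+1} :=
  [ffun j : 'I_d => inord (absz (u 0 j - Num.ceil (a 0 j))%R)].
have gE (u : 'rV[int]_d) (j : 'I_d) : u \in t ->
    exists2 k : nat, u 0 j = Num.ceil (a 0 j) + k%:Z & (k < n j)%N.
  move=> /tab/(_ j); rewrite mxE => /andP[au ub].
  have uc : 0 <= u 0 j - Num.ceil (a 0 j) by rewrite subr_ge0 ceil_le_int.
  have uE : u 0 j = Num.ceil (a 0 j) + (absz (u 0 j - Num.ceil (a 0 j))%R)%:Z.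
    by rewrite gez0_abs// addrC subrK.
  exists (absz (u 0 j - Num.ceil (a 0 j))%R) => //.
  rewrite ltnS truncn_ge_nat ?subr_ge0//.
  have := ceil_ge (a 0 j); move: ub; rewrite [in X in X -> _]uE intrD.
  by rewrite -pmulrn; lra.
have ginj : {in t &, injective g}.
  move=> u v ut' vt guv; apply/rowP => j.
  have [k uE kn] := gE u j ut'; have [l vE ln] := gE v j vt.
  have /ffunP/(_ j) := guv; rewrite !ffunE uE vE ![_ + _ - _]addrAC !subrr !add0r.
  move=> /(congr1 val); rewrite /= !inordK => [->//||]; rewrite ltnS ltnW//.
    exact: leq_trans (nK j).
  exact: leq_trans (nK j).
have -> : size t = #|[seq g u | u <- t]|.
  by have /card_uniqP -> : uniq [seq g u | u <- t]; rewrite ?size_map// map_inj_in_uniq.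
pose F (j : 'I_d) := [pred i : 'I_K.+1 | (i < n j)%N].
have : (#|[seq g u | u <- t]| <= #|family F|)%N.
  apply: subset_leq_card; apply/fintype.subsetP => _ /mapP[u ut' ->]; apply/familyP => j.
  have [k uE kn] := gE u j ut'; rewrite ffunE uE addrAC subrr add0r absz_nat inE.
  by rewrite inordK// ltnS (leq_trans (ltnW kn) (nK j)).
rewrite -(ler_nat R) => /le_trans; apply.
rewrite card_family foldrE big_map big_enum/= natr_prod.
apply: ler_prod => j _; rewrite ler0n /=.
have nK1 : (n j <= K.+1)%N by rewrite (leq_trans (nK j)).
rewrite -sum1_card (big_ord_narrow nK1).
rewrite sum1_card card_ord /n -natr1 lerD2r.
by rewrite truncn_le subr_ge0.
Qed.

Lemma box_scale a b (p : R) (x : 'rV[R]_d) : 0 < p ->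
  box a b x -> box (p *: a) (p *: b) (p *: x).
Proof. by move=> p0 abx j; rewrite !mxE !ler_pM2l. Qed.

(* Count the points of the grid [p^-1 Z^d] on both sides and let [p] tend to
   infinity. *)
Lemma size_cover_ge (n : nat) (a b : 'I_n -> 'rV[R]_d) (s : seq 'rV[int]_d) :
  (forall i j, a i 0 j <= b i 0 j) -> uniq s ->
  {in s, forall z, ucell z `<=` \bigcup_i box (a i) (b i)} ->
  (size s)%:R <= \sum_i boxvol (a i) (b i).
Proof.
move=> ab us sU.
pose P : {poly R} := \sum_i \prod_j ((b i 0 j - a i 0 j)%:P + 'X).
have PE u : P.[u] = \sum_i \prod_j (b i 0 j - a i 0 j + u).
  rewrite /P horner_sum; apply: eq_bigr => i _; rewrite horner_prod.
  by apply: eq_bigr => j _; rewrite hornerD hornerC hornerX.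
have -> : \sum_i boxvol (a i) (b i) = P.[0].
  by rewrite PE; apply: eq_bigr => i _; apply: eq_bigr => j _; rewrite addr0.
have : P.[harmonic k] @[k --> \oo] --> P.[0].
  by apply: continuous_cvg; [exact: continuous_horner|exact: cvg_harmonic].
move/cvgr_to_ge; apply; apply: nearW => p' /=; set p := p'.+1.
have p0 : 0 < p%:R :> R by rewrite ltr0n.
(* Scaled by [p], cell [z] contributes the p^d points p z + q with 0 <= q_j < p. Omitting the upper
   faces keeps the points of different cells distinct: Euclidean division by [p] recovers [z] and
   [q]. *)
pose h (z : 'rV[int]_d) (q : {ffun 'I_d -> 'I_p}) : 'rV[int]_d :=
  \row_j (p%:Z * z 0 j + (q j : nat)%:Z).
pose U := [seq h z q | z <- s, q <- enum {ffun 'I_d -> 'I_p}].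
have sU' : size U = (size s * p ^ d)%N.
  by rewrite size_allpairs -cardT card_ffun !card_ord.
have uU : uniq U.
  apply: allpairs_uniq; rewrite ?enum_uniq// => -[z q] [z' q'] _ _ /= E.
  have Ej (j : 'I_d) : z 0 j = z' 0 j /\ q j = q' j.
    have /rowP/(_ j) := E; rewrite !mxE => {}E.
    have [lq lq'] := (ltn_ord (q j), ltn_ord (q' j)).
    have zz : z 0 j = z' 0 j.
      have := congr1 (fun x => (x %/ p%:Z)%Z) E.
      by rewrite ![p%:Z * _]mulrC !divzMDl// !divz_small ?addr0//; apply/andP.
    by split=> //; apply/val_inj; move: E; rewrite zz => /addrI [].
  by congr (_, _); [apply/rowP => j|apply/ffunP => j]; have [] := Ej j.
have UE u : u \in U -> exists i, box (p%:R *: a i) (p%:R *: b i) (zr R u).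
  move=> /allpairsP[[z q] /= [zs _ ->]].
  have [|i _ bi] := sU z zs (p%:R^-1 *: zr R (h z q)).
    move=> j; rewrite !mxE intrD intrM -!pmulrn mulrDr mulKf ?gt_eqF//.
    rewrite lerDl lerD2l mulr_ge0 ?invr_ge0 ?ler0n//= ler_pdivrMl// mulr1 ler_nat.
    exact: ltnW (ltn_ord _).
  exists i; have := box_scale p0 bi.
  by rewrite scalerA mulfV ?gt_eqF// scale1r.
have szU : (size U)%:R <= \sum_i \prod_j (p%:R * (b i 0 j - a i 0 j) + 1).
  apply: (@le_trans _ _ (\sum_i
      (size [seq u <- U | `[< box (p%:R *: a i) (p%:R *: b i) (zr R u) >]])%:R)).
    rewrite -natr_sum ler_nat; apply: size_le_sum_filter => u /UE[i bi].
    by exists i; rewrite asboolT.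
  apply: ler_sum => i _; apply: le_trans (@size_int_box (p%:R *: a i) (p%:R *: b i) _ _ _ _) _.
  - by move=> j; rewrite !mxE ler_pM2l.
  - exact: filter_uniq.
  - by move=> u; rewrite mem_filter => /andP[/asboolP].
  by under eq_bigr do rewrite !mxE -mulrBr.
rewrite -(ler_pM2r (exprn_gt0 d p0)); move: szU.
have -> : \sum_i \prod_j (p%:R * (b i 0 j - a i 0 j) + 1) = P.[p%:R^-1] * p%:R ^+ d.
  rewrite PE mulr_suml; apply: eq_bigr => i _.
  rewrite -[X in _ ^+ X]card_ord -prodr_const -big_split/=; apply: eq_bigr => j _.
  by rewrite mulrDl mulVf ?gt_eqF// mulrC.
by rewrite -natrX -natrM -sU'.
Qed.
End IntegerPoints.

(** * Volume against the number of unit cubes *)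

Section CellVolume.
Variables (R : realType) (d : nat).
Implicit Types (a b : 'rV[R]_d) (W : set 'rV[R]_d).

Lemma boxvol_fatten a b (e : R) : 0 < e ->
  exists2 del : R, 0 < del &
    boxvol (a - const_mx del) (b + const_mx del) <= boxvol a b + e.
Proof.
move=> e0.
pose p : {poly R} := \prod_j ((b 0 j - a 0 j)%:P + 2%:P * 'X).
have pE u : p.[u] = boxvol (a - const_mx u) (b + const_mx u).
  rewrite /p horner_prod; apply: eq_bigr => j _.
  by rewrite hornerD hornerM !hornerC hornerX !mxE; ring.
have p0 : p.[0] = boxvol a b.
  by rewrite pE (_ : const_mx 0 = 0) ?subr0 ?addr0//; apply/matrixP => i j; rewrite !mxE.
have cp : p.[harmonic n] @[n --> \oo] --> p.[0].
  by apply: continuous_cvg; [exact: continuous_horner|exact: cvg_harmonic].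
have [n _ /(_ n (leqnn n)) /= pn] := cvgr_lt _ cp _ (ltr_pwDr e0 (lexx p.[0])).
exists n.+1%:R^-1; first by rewrite invr_gt0.
by rewrite -pE -p0 ltW.
Qed.

Lemma open_box a b : open [set x : 'rV[R]_d | forall j, a 0 j < x 0 j < b 0 j].
Proof.
rewrite openE => x abx; rewrite /interior.
exists (fun i j => [set` `]a 0 j, b 0 j[]).
  by move=> i j; rewrite ord1; apply: near_in_itvoo; rewrite in_itv/=.
by move=> u /= ub j; have := ub 0 j; rewrite /= in_itv.
Qed.

Lemma compact_box a b : compact (box a b).
Proof.
have := @rV_compact R d (fun j => [set` `[a 0 j, b 0 j]]) (fun j => @segment_compact R _ _).
by congr compact; apply/seteqP; split=> x /= H j; have := H j; rewrite in_itv.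
Qed.

(* By compactness finitely many slightly fattened boxes of a cover suffice. *)
Lemma card_le_vol W (s : seq 'rV[int]_d) :
  uniq s -> {in s, forall z, ucell z `<=` W} -> ((size s)%:R%:E <= vol W)%E.
Proof.
move=> us sW; have [->|Woo] := eqVneq (vol W) +oo%E; first by rewrite leey.
have fW : vol W \is a fin_num by rewrite ge0_fin_numE ?vol_ge0// ltey.
apply/lee_addgt0Pr => e e0; have e20 : 0 < e / 2 by rewrite divr_gt0.
have [[a b] /= [ab Wab le]] := vol_cover e20 fW.
have ek0 k : 0 < e / 2 / (2 ^ k.+1)%:R by rewrite divr_gt0// ltr0n expn_gt0.
have [del delP] := choice (fun k => (exists2P _ _).1 (boxvol_fatten (a k) (b k) (ek0 k))).
pose a' k := a k - const_mx (del k); pose b' k := b k + const_mx (del k).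
have del0 k : 0 < del k by have [] := delP k.
have ab' k j : a' k 0 j <= b' k 0 j.
  rewrite !mxE; have := del0 k; have := ab k j; lra.
pose K : set 'rV[R]_d := \big[setU/set0]_(z <- s) ucell z.
have cK : compact K by apply: bigsetU_compact => z _; exact: compact_box.
pose f k : set 'rV[R]_d := [set x | forall j, a' k 0 j < x 0 j < b' k 0 j].
have KW : K `<=` W.
  move=> x; rewrite /K big_seq; elim/big_ind: _ => //.
  - by move=> A B HA HB [].
  - by move=> z zs; apply: sW.
move: cK; rewrite compact_cover => /(_ nat setT f).
case=> [k _|x /KW/Wab[k _ bx]|D' _ KD]; first exact: open_box.
  exists k => // j; have := bx j; rewrite !mxE; have := del0 k; lra.
pose D := finmap.enum_fset D'.
have szs : (size s)%:R <= \sum_(k <- D) boxvol (a' k) (b' k).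
  rewrite (big_nth 0%N) big_mkord.
  apply: (@size_cover_ge _ _ _ (fun i => a' (nth 0%N D i)) (fun i => b' (nth 0%N D i))) => //.
  move=> z zs x zx; have /KD[k kD fkx] : K x by rewrite /K -bigcup_seq; exists z.
  have ltk : (index k D < size D)%N by rewrite index_mem.
  exists (Ordinal ltk) => //= j; rewrite nth_index//.
  by have /andP[x1 x2] := fkx j; rewrite !ltW.
have ek0' k : (0 <= (boxvol (a k) (b k))%:E :> \bar R)%E by rewrite lee_fin boxvol_ge0.
apply: (@le_trans _ _ (\sum_(k <- D) ((boxvol (a k) (b k))%:E + (e / 2 / (2 ^ k.+1)%:R)%:E))%E).
  under eq_bigr do rewrite -EFinD.
  rewrite sumEFin lee_fin (le_trans szs)//; apply: ler_sum => k _.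
  by have [] := delP k.
apply: (le_trans (lee_sum_fset_lim D' xpredT _)).
  by move=> k _; rewrite adde_ge0// lee_fin ltW.
apply: (le_trans (epsilon_trick _ ek0' (ltW e20))).
rewrite [e in leRHS]splitr EFinD addeA leeD2r//; exact: le.
Qed.

Lemma vol_le_card W (s : seq 'rV[int]_d) : (0 < d)%N ->
  W `<=` \bigcup_(z in [set` s]) ucell z -> (vol W <= (size s)%:R%:E)%E.
Proof.
move=> d0 Ws.
apply: le_trans (@vol_bigcup_fin _ _ d0 W (size s) (fun i => ucell (nth 0 s i)) _) _.
  move=> x /Ws[z /= zs xz]; have lts : (index z s < size s)%N by rewrite index_mem.
  by exists (Ordinal lts) => //=; rewrite nth_index.
apply: (@le_trans _ _ (\sum_(i < size s) 1%:E)%E); last first.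
  by rewrite sumEFin lee_fin sumr_const card_ord.
apply: lee_sum => i _; apply: le_trans (vol_box d0 _) _.
  by move=> j; rewrite !mxE lerDl.
rewrite lee_fin /boxvol big1// => j _; rewrite !mxE; ring.
Qed.
End CellVolume.

Section EuclideanNorm.
Variables (R : realType) (d : nat).
Implicit Types (x : 'rV[R]_d).

Lemma enorm_ge0 x : 0 <= enorm x. Proof. exact: sqrtr_ge0. Qed.

Lemma enorm_sqr x : enorm x ^+ 2 = \sum_j x 0 j ^+ 2.
Proof. by rewrite sqr_sqrtr// sumr_ge0// => j _; exact: sqr_ge0. Qed.

Lemma coord_le_enorm x j : `|x 0 j| <= enorm x.
Proof.
rewrite -(@ler_pXn2r _ 2)// ?nnegrE ?enorm_ge0// enorm_sqr real_normK ?num_real//.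
by rewrite (bigD1 j)//= lerDl sumr_ge0// => i _; exact: sqr_ge0.
Qed.

(** The crude factor [d] in place of its square root keeps the constants free of roots. *)
Lemma enorm_le x (c : R) : 0 <= c -> (forall j, `|x 0 j| <= c) -> enorm x <= d%:R * c.
Proof.
move=> c0 xc; rewrite -(@ler_pXn2r _ 2)// ?nnegrE ?enorm_ge0 ?mulr_ge0// enorm_sqr.
apply: (@le_trans _ _ (\sum_(j < d) c ^+ 2)).
  apply: ler_sum => j _; rewrite -(real_normK (num_real (x 0 j))).
  by rewrite ler_pXn2r ?nnegrE// xc.
rewrite sumr_const card_ord -[leLHS]mulr_natl exprMn ler_wpM2r ?sqr_ge0//.
by rewrite -natrX ler_nat; case: (d) => // n; rewrite expnS expn1 leq_pmulr.
Qed.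
End EuclideanNorm.

(** * Unit cubes meeting the boundary *)

Section BoundaryCells.
Variables (R : realType) (d : nat).
Implicit Types (a b : 'rV[R]_d) (W : set 'rV[R]_d).

(** The segment from [p] to [q] stays in the box, hence off the boundary of [W]. There the interior
    and the closure of [W] cut out the same part of it, which is open, closed and contains [p];
    connectedness makes it the whole segment. *)
Lemma box_bdry a b W p : box a b p -> W p ->
  (forall x, box a b x -> ~ bdry W x) -> box a b `<=` W.
Proof.
move=> bp Wp nW q bq.
pose f (t : R) : 'rV[R]_d := p + t *: (q - p).
have cf : continuous f.
  by move=> t; apply: cvgD; [exact: cvg_cst|apply: cvgZr_tmp; exact: cvg_id].
have fb t : `[0, 1]%classic t -> box a b (f t).
  rewrite /= in_itv/= => /andP[t0 t1] j; have := bp j; have := bq j; rewrite !mxE; nra.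
have cA : connected (f @` `[0, 1]).
  apply: connected_continuous_connected; first exact: segment_connected.
  exact: continuous_subspaceT.
have E : f @` `[0, 1] `&` W = f @` `[0, 1].
  apply: cA.
  - exists p; split=> //; exists 0; first by rewrite /= in_itv/= lexx ler01.
    by rewrite /f scale0r addr0.
  - exists W°; first exact: open_interior.
    apply/seteqP; split=> x [Ax]; last by move/interior_subset.
    move=> Wx; split=> //; apply: contrapT => nx; case: Ax => t t01 fx.
    by apply: (nW x); [rewrite -fx; exact: fb|split=> //; exact: subset_closure].
  - exists (closure W); first exact: closed_closure.
    apply/seteqP; split=> x [Ax]; first by move/subset_closure.
    move=> Wx; split=> //; apply: contrapT => nx; case: Ax => t t01 fx.
    apply: (nW x); [rewrite -fx; exact: fb|split=> //].
    by move/interior_subset.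
have : (f @` `[0, 1]) q.
  by exists 1; [rewrite /= in_itv/= lexx ler01|rewrite /f scale1r addrC subrK].
by rewrite -E => -[].
Qed.

(* A unit cube that meets [W] but not its boundary is contained in [W]. *)
Lemma lattice_count W (s : seq 'rV[int]_d) : (0 < d)%N -> uniq s ->
  (forall z x, ucell z x -> W x -> z \in s) ->
  `|(size [seq z <- s | `[< W (zr R z) >]])%:R - fine (vol W)| <=
  (size [seq z <- s | `[< exists2 x, ucell z x & bdry W x >]])%:R.
Proof.
move=> d0 us Ws.
set sW := seq.filter _ s; set sB := seq.filter (fun z => `[< exists2 x, _ & _ >]) s.
pose sI := [seq z <- s | `[< ucell z `<=` W >]].
have cz (z : 'rV[int]_d) : ucell z (zr R z) by move=> j; rewrite !mxE lexx lerDl ler01.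
have meets z x : ucell z x -> W x -> z \in sI ++ sB.
  move=> zx Wx; rewrite mem_cat !mem_filter (Ws z x)// !andbT.
  have [/asboolP|/asboolPn nb] := boolP `[< exists2 x, ucell z x & bdry W x >].
    by rewrite orbT.
  rewrite orbF; apply/asboolP; apply: (box_bdry zx Wx) => y zy By.
  by apply: nb; exists y.
(* The count [size sW] and the volume are both squeezed between [size sI] and [size sI + size sB],
   so they differ by at most [size sB]. *)
have lo : (size sI <= size sW)%N.
  rewrite uniq_leq_size ?filter_uniq// => z; rewrite !mem_filter => /andP[/asboolP zW ->].
  by rewrite andbT; apply/asboolP/zW/cz.
have hi : (size sW <= size sI + size sB)%N.
  rewrite -size_cat uniq_leq_size ?filter_uniq// => z; rewrite mem_filter => /andP[/asboolP Wz _].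
  exact: meets _ _ (cz z) Wz.
have vlo : ((size sI)%:R%:E <= vol W)%E.
  by apply: card_le_vol; rewrite ?filter_uniq// => z; rewrite mem_filter => /andP[/asboolP].
have vhi : (vol W <= (size sI + size sB)%:R%:E)%E.
  rewrite -size_cat; apply: vol_le_card => // x Wx.
  pose z : 'rV[int]_d := \row_j Num.floor (x 0 j).
  have zx : ucell z x.
    move=> j; rewrite !mxE; have /andP[h1 h2] := floor_itv (x 0 j).
    by rewrite h1 ltW// -intrD1.
  by exists z => //=; exact: meets _ _ zx Wx.
have fW : vol W \is a fin_num.
  by rewrite ge0_fin_numE ?vol_ge0// (le_lt_trans vhi) ?ltry.
move: vlo vhi; rewrite -(fineK fW) !lee_fin natrD => vlo vhi.
move: lo hi; rewrite -(ler_nat R) -[(size sW <= _)%N](ler_nat R) natrD => lo hi.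
rewrite ler_norml; apply/andP; split; lra.
Qed.

(** A grid of mesh 1/k with k >= L d on the parameter cube places every boundary point within
    distance 1 of the image P of one of k^(d-1) grid points for one of the M maps. The corner of a
    unit cube through such a point then has coordinates between P_j - 2 and P_j + 1, which leaves at
    most 4^d cubes for each P. *)
Lemma size_bdry_cells W (M : nat) (L : R) (t : seq 'rV[int]_d) :
  0 <= L -> Lip M L (bdry W) -> uniq t ->
  {in t, forall z, exists2 x, ucell z x & bdry W x} ->
  (size t)%:R <= M%:R * (d%:R * (L + 1)) ^+ d.-1 * 4 ^+ d.
Proof.
move=> L0 [phi [phiL Wphi]] ut tB.
have [d0|d0] := posnP d.
  have tM : (size t <= M)%N.
    rewrite -[M]card_ord -sum1_card.
    have /size_le_sum_filter : {in t, forall z, exists i : 'I_M, xpredT z}.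
      by move=> z /tB[x _ /Wphi[i _ _]]; exists i.
    move/leq_trans; apply; apply: leq_sum => i _; rewrite filter_predT.
    have : {subset t <= [:: 0]}.
      by move=> z _; rewrite inE; apply/eqP/rowP => -[j jd]; exfalso; rewrite d0 in jd.
    by move/(uniq_leq_size ut).
  have -> : d.-1 = 0%N by rewrite d0.
  by rewrite expr0 mulr1 [X in 4 ^+ X]d0 expr0 mulr1 ler_nat.
set k := (Num.truncn (L * d%:R)).+1.
have k0 : 0 < k%:R :> R by rewrite ltr0n.
have Ldk : L * d%:R <= k%:R by rewrite ltW// truncnS_gt.
have kL : k%:R <= d%:R * (L + 1).
  rewrite /k -natr1 mulrDr mulr1 lerD//; first by rewrite [leRHS]mulrC truncn_le mulr_ge0.
  by rewrite (ler_nat R 1).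
pose g (q : {ffun 'I_d.-1 -> 'I_k}) : 'rV[R]_d.-1 := \row_j ((q j)%:R / k%:R).
have gq q : unit_cube (g q).
  move=> j; rewrite mxE divr_ge0 ?ler0n//= ler_pdivrMr// mul1r ler_nat.
  exact: ltnW (ltn_ord _).
pose P (iq : 'I_M * {ffun 'I_d.-1 -> 'I_k}) := phi iq.1 (g iq.2).
pose B iq := box (P iq - const_mx 2) (P iq + const_mx 1).
have tP : {in t, forall z, exists iq, `[< B iq (zr R z) >]}.
  move=> z /tB[x zx /Wphi[i _ [u uc ux]]].
  rewrite -{x}ux in zx.
  have /choice[q qP] (j : 'I_d.-1) : exists q : 'I_k, `|u 0 j - q%:R / k%:R| <= k%:R^-1.
    have /andP[u0 u1] := uc j.
    have [u1'|u1'] := leP 1 (u 0 j).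
      exists ord_max; have -> : u 0 j = 1 by apply/eqP; rewrite eq_le u1.
      rewrite /= -[X in X - _](@divff _ k%:R) ?gt_eqF// -mulrBl /k -natr1 addrAC subrr add0r.
      by rewrite mul1r ger0_norm// invr_ge0 ler0n.
    have uk : (Num.truncn (u 0 j * k%:R)%R < k)%N.
      by rewrite truncn_lt_nat ?mulr_ge0// gtr_pMl.
    exists (Ordinal uk) => /=.
    have /andP[h1 h2] := truncn_itv (mulr_ge0 u0 (ltW k0)).
    rewrite -[X in X - _](@mulfK _ k%:R) ?gt_eqF// -mulrBl normrM [X in _ * X]ger0_norm ?invr_ge0 ?ler0n//.
    rewrite ler_piMl ?invr_ge0 ?ler0n// ger0_norm ?subr_ge0// lerBlDl.
    by rewrite natr1 ltW.
  exists (i, [ffun j => q j]); apply/asboolP.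
  have dist : enorm (phi i u - P (i, [ffun j => q j])) <= 1.
    apply: le_trans (phiL _ _ _ uc (gq _)) _.
    apply: (@le_trans _ _ (L * (d%:R * k%:R^-1))); last by rewrite mulrA ler_pdivrMr// mul1r.
    rewrite ler_wpM2l//; apply: (@le_trans _ _ (d.-1%:R * k%:R^-1)).
      apply: enorm_le => [|j]; first by rewrite invr_ge0 ler0n.
      by rewrite !mxE ffunE.
    by rewrite ler_wpM2r ?invr_ge0 ?ler0n// ler_nat leq_pred.
  move=> j; have := le_trans (coord_le_enorm _ j) dist; have := zx j.
  rewrite !mxE ler_norml; move: (P _ 0 j) => y; move: (phi i u 0 j) => x; lra.
have := size_le_sum_filter tP; rewrite -(ler_nat R) => /le_trans; apply.
rewrite natr_sum; apply: (@le_trans _ _ (\sum_(iq : 'I_M * {ffun 'I_d.-1 -> 'I_k}) 4 ^+ d)).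
  apply: ler_sum => iq _.
  apply: le_trans (@size_int_box R d (P iq - const_mx 2) (P iq + const_mx 1) _ _ _ _) _.
  - by move=> j; rewrite !mxE; lra.
  - exact: filter_uniq.
  - by move=> z; rewrite mem_filter => /andP[/asboolP].
  rewrite -[X in _ <= _ ^+ X]card_ord -prodr_const; apply: ler_prod => j _.
  rewrite !mxE; apply/andP; split; lra.
rewrite sumr_const card_prod card_ffun !card_ord -[leLHS]mulr_natl ler_wpM2r ?exprn_ge0//.
rewrite natrM natrX ler_wpM2l//.
by rewrite lerXn2r// ?nnegrE ?(le_trans (ltW k0)).
Qed.
End BoundaryCells.

(** * Reduced bases *)

Section Projection.
Variables (R : realType) (e : nat).
Implicit Types (u v w : 'rV[R]_e).

Lemma mulmx_tr_enorm v : v *m v^T = (enorm v ^+ 2)%:M.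
Proof.
apply/matrixP => i j; rewrite !ord1 !mxE eqxx mulr1n enorm_sqr.
by apply: eq_bigr => k _; rewrite mxE expr2.
Qed.

Lemma enormZ (k : R) v : enorm (k *: v) = `|k| * enorm v.
Proof.
apply/eqP; rewrite -(@eqrXn2 _ 2)// ?mulr_ge0 ?enorm_ge0//.
rewrite exprMn !enorm_sqr real_normK ?num_real// mulr_sumr.
by apply/eqP/eq_bigr => j _; rewrite mxE exprMn.
Qed.

Lemma enorm0 : enorm (0 : 'rV[R]_e) = 0.
Proof. by rewrite -(scale0r 0) enormZ normr0 mul0r. Qed.

Lemma enorm_eq0 v : enorm v = 0 -> v = 0.
Proof.
move=> v0; apply/rowP => j; rewrite mxE; apply/eqP; rewrite -normr_eq0.
by rewrite eq_le normr_ge0 andbT -v0 coord_le_enorm.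
Qed.

Lemma enorm_pythagoras (t : R) v w : w *m v^T = 0 ->
  enorm (t *: v + w) ^+ 2 = (t * enorm v) ^+ 2 + enorm w ^+ 2.
Proof.
move=> wv; have vw : v *m w^T = 0 by rewrite -[LHS]trmxK trmx_mul trmxK wv trmx0.
have := mulmx_tr_enorm (t *: v + w).
rewrite linearD linearZ /= mulmxDl !mulmxDr -!scalemxAl -!scalemxAr wv vw !mulmx_tr_enorm.
move/matrixP/(_ 0 0); rewrite !mxE !eqxx /= !mulr1n => <-.
by rewrite !mulr0 !addr0 add0r exprMn expr2 mulrA.
Qed.

End Projection.

Section ReducedBasis.
Variables (R : realType) (e : nat).

Lemma zrM d n (z : 'rV[int]_d) (A : 'M[int]_(d, n)) :
  zr R (z *m A) = zr R z *m map_mx intr A.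
Proof. exact: map_mxM. Qed.

Lemma zr_eq0 d (z : 'rV[int]_d) : zr R z = 0 -> z = 0.
Proof.
move/rowP => z0; apply/rowP => j; have := z0 j; rewrite !mxE => /eqP.
by rewrite intr_eq0 => /eqP.
Qed.

(* An almost minimal vector extends to a basis by the Smith normal form. *)
Lemma almost_min_row d (B : 'M[R]_(1 + d, e)) (lam : R) : 0 < lam ->
  (forall z : 'rV[int]_(1 + d), z != 0 -> lam <= enorm (zr R z *m B)) ->
  exists2 A : 'M[int]_(1 + d), A \in unitmx &
  forall z : 'rV[int]_(1 + d), z != 0 ->
    4 * enorm (row 0 (map_mx intr A *m B)) <= 5 * enorm (zr R z *m B).
Proof.
move=> lam0 Bmin.
pose E := [set enorm (zr R z *m B) | z in [set z : 'rV[int]_(1 + d) | z != 0]].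
have lE : lbound E lam by move=> _ [z z0 <-]; exact: Bmin.
have d10 : delta_mx 0 0 != 0 :> 'rV[int]_(1 + d).
  by apply/eqP => /rowP/(_ 0); rewrite !mxE !eqxx.
have hE : has_inf E.
  by split; [exists (enorm (zr R (delta_mx 0 0) *m B)), (delta_mx 0 0)|exists lam].
have m0 : 0 < inf E.
  by apply: lt_le_trans lam0 _; apply: lb_le_inf => //; exact: hE.1.
(* A vector within a factor 5/4 of the infimum is enough: the projection argument for
   [reduced_basis] tolerates factors up to the square root of 2. *)
have [_ [z0 z0N <-] z0E] := inf_adherent (divr_gt0 m0 (ltr0n R 4)) hE.
have z0min z : z != 0 -> 4 * enorm (zr R z0 *m B) <= 5 * enorm (zr R z *m B).
  move=> zN; have : inf E <= enorm (zr R z *m B).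
    by apply: (ge_inf hE.2); exists z.
  by move: z0E; rewrite -/E; lra.
(* For a matrix with one row the diagonal form has a single entry, so [z0] is an integer multiple of
   row 0 of the unimodular matrix [A]; that row gives a vector no longer than the one of [z0]. *)
have [L _ [A uA [D _ z0D]]] := int_Smith_normal_form z0.
exists A => // z zN; apply: le_trans (z0min z zN); rewrite ler_pM2l//.
have [k z0k] : exists k : int, z0 = k *: row 0 A.
  exists (L 0 0 * D`_0); rewrite z0D; apply/rowP => j.
  rewrite !mxE (bigD1 0)//= big1 ?addr0.
    by rewrite !mxE big_ord1 mxE eqxx mulr1n.
  move=> i iN; rewrite !mxE big_ord1 !mxE /=.
  have -> : (0%N == i) = false by apply/eqP => i0; case/eqP: iN; apply/val_inj.
  by rewrite mulr0n mulr0 mul0r.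
have kN : k != 0 by apply: contraNneq z0N => k0; rewrite z0k k0 scale0r.
have -> : zr R z0 *m B = k%:~R *: row 0 (map_mx intr A *m B).
  rewrite z0k row_mul -map_row scalemxAl; congr (_ *m _).
  by apply/rowP => j; rewrite !mxE intrM.
rewrite enormZ ler_peMl ?enorm_ge0// -intr_norm (ler_int R 1).
by rewrite -gtz0_ge1 normr_gt0.
Qed.

(* Project along an almost minimal vector [b]: modulo [b] every lattice point can
   be moved to within [enorm b / 2] of its projection, so the projected lattice
   has minimum at least [lam / 2].  The recursion for the constant is solved by
   [d`!]. *)
Lemma reduced_basis d (B : 'M[R]_(d, e)) (lam : R) : 0 < lam ->
  (forall z : 'rV[int]_d, z != 0 -> lam <= enorm (zr R z *m B)) ->
  exists2 U : 'M[int]_d, U \in unitmx &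
  forall (c : 'rV[R]_d) i,
    `|c 0 i| * lam <= d`!%:R * enorm (c *m map_mx intr U *m B).
Proof.
elim: d B lam => [|d IH] B lam lam0 Bmin.
  by exists 1%:M; [exact: unitmx1|move=> c []].
have [A uA Amin] := @almost_min_row d B lam lam0 Bmin.
set B1 := map_mx intr A *m B in Amin.
have B1min (z : 'rV[int]_(1 + d)) : z != 0 -> z *m A != 0.
  by apply: contraNneq => zA; rewrite -(mulmxK uA z) zA mul0mx.
pose b : 'rV[R]_e := usubmx (B1 : 'M[R]_(1 + d, e)).
pose B' : 'M[R]_(d, e) := dsubmx (B1 : 'M[R]_(1 + d, e)).
have B1E : B1 = col_mx b B' by rewrite vsubmxK.
have bE : row 0 B1 = b.
  by apply/rowP => j; rewrite [LHS]mxE [RHS]mxE; congr (B1 _ _); apply/val_inj.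
have bmin (z : 'rV[int]_(1 + d)) : z != 0 -> 4 * enorm b <= 5 * enorm (zr R z *m B1).
  by move=> zN; rewrite /B1 mulmxA -zrM -bE; apply/Amin/B1min.
have lamb : lam <= enorm b.
  have d10 : delta_mx 0 0 != 0 :> 'rV[int]_(1 + d).
    by apply/eqP => /rowP/(_ 0); rewrite !mxE !eqxx.
  have := Bmin _ (B1min _ d10); rewrite -bE zrM -mulmxA -/B1 rowE.
  by congr (_ <= enorm (_ *m _)); apply/rowP => j; rewrite !mxE; case: (_ && _).
have b0 : 0 < enorm b by exact: lt_le_trans lamb.
(* The Gram-Schmidt coefficients along [b]: the rows of [B2] are those of [B'] projected onto the
   orthogonal complement of [b]. *)
pose p : 'cV[R]_d := (enorm b ^+ 2)^-1 *: (B' *m b^T).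
pose B2 := B' - p *m b.
have B2b : B2 *m b^T = 0.
  rewrite mulmxBl -mulmxA mulmx_tr_enorm mul_mx_scalar scalerA divff ?scale1r ?subrr//.
  by rewrite expf_neq0// gt_eqF.
have dec (c0 : 'rV[R]_1) (c' : 'rV[R]_d) :
    row_mx c0 c' *m B1 = (c0 + c' *m p) 0 0 *: b + c' *m B2.
  rewrite B1E mul_row_col /B2 mulmxBr mulmxA -mul_scalar_mx.
  have -> : ((c0 + c' *m p) 0 0)%:M = c0 + c' *m p.
    by apply/matrixP => i j; rewrite !ord1 mxE eqxx.
  by rewrite mulmxDl -!addrA; congr (_ + _); rewrite addrC subrK.
have pyth (c0 : 'rV[R]_1) (c' : 'rV[R]_d) :
    enorm (row_mx c0 c' *m B1) ^+ 2 =
    ((c0 + c' *m p) 0 0 * enorm b) ^+ 2 + enorm (c' *m B2) ^+ 2.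
  by rewrite dec enorm_pythagoras// -mulmxA B2b mulmx0.
have lam20 : 0 < lam / 2 by rewrite divr_gt0.
have round (x : R) : exists k : int, `|k%:~R + x| <= 2^-1.
  exists (- Num.floor (x + 2^-1)); have /andP[] := floor_itv (x + 2^-1).
  by rewrite intrD1 mulrNz ler_norml => h1 h2; apply/andP; split; lra.
have [|U' uU' redU'] := IH B2 (lam / 2) lam20.
  (* The projected point is lifted by the multiple [k] of [b] for which the component along [b] is
     at most half of [b]. *)
  move=> z' z'N; have [k kp] := round ((zr R z' *m p) 0 0).
  have zN : row_mx (k%:M) z' != 0 :> 'rV[int]_(1 + d).
    apply: contraNneq z'N => /rowP z0; apply/eqP/rowP => j.
    by have := z0 (rshift 1 j); rewrite row_mxEr !mxE.
  have := bmin _ zN; rewrite /zr map_row_mx /= => bz.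
  have {bz} : (4 * enorm b) ^+ 2 <= (5 * enorm (row_mx (map_mx intr k%:M) (zr R z') *m B1)) ^+ 2.
    by rewrite lerXn2r ?nnegrE// mulr_ge0 ?enorm_ge0.
  rewrite [leRHS]exprMn pyth; set t := fun_of_matrix _ 0 0.
  have {kp} : `|t| <= 2^-1 by rewrite /t !mxE eqxx mulr1n in kp *.
  rewrite -(@ler_pXn2r _ 2)// ?nnegrE ?invr_ge0// real_normK ?num_real// => t4.
  have : (t * enorm b) ^+ 2 <= 2^-1 ^+ 2 * enorm b ^+ 2.
    by rewrite exprMn ler_wpM2r ?sqr_ge0.
  have : lam ^+ 2 <= enorm b ^+ 2 by rewrite lerXn2r ?nnegrE ?enorm_ge0 ?(ltW lam0).
  (* If r is the norm of the projected point, then 16 |b|^2 <= 25 (|b|^2 / 4 + r^2), so r^2 >=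
     (39/100) |b|^2 >= (lam / 2)^2. *)
  move=> h1 h2 h3.
  rewrite -(@ler_pXn2r _ 2)// ?nnegrE ?enorm_ge0 ?(ltW lam20)//.
  move: h1 h2 h3 (sqr_ge0 lam); move: ((t * enorm b) ^+ 2) => w; rewrite !exprMn.
  move: (enorm b ^+ 2) (enorm (_ *m B2) ^+ 2) (lam ^+ 2) => x y l.
  have -> : 2^-1 ^+ 2 = 1 / 4 :> R by field.
  have -> : 4 ^+ 2 = 16 :> R by ring.
  have -> : 5 ^+ 2 = 25 :> R by ring.
  lra.
(* Size reduction: the lifted basis vectors are shifted by integer multiples of [b] so that their
   coefficients along [b] are at most 1/2. *)
have /choice[s sP] i := round ((map_mx intr U' *m p) i 0).
pose S : 'M[int]_(1 + d) := block_mx 1%:M 0 (\col_i s i) U'.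
have uS : S \in unitmx by rewrite unitmxE (det_lblock 1%:M) det1 mul1r -unitmxE.
exists (S *m A); first by rewrite unitmx_mul uS uA.
move=> c i.
have [c0 [c' cE]] : exists c0 c', c = row_mx c0 c' :> 'rV[R]_(1 + d).
  by exists (lsubmx (c : 'rV[R]_(1 + d))), (rsubmx (c : 'rV[R]_(1 + d))); rewrite hsubmxK.
have -> : c *m map_mx intr (S *m A : 'M[int]_(1 + d)) *m B =
    row_mx (c0 + c' *m map_mx intr (\col_i s i)) (c' *m map_mx intr U') *m B1.
  rewrite map_mxM mulmxA -[_ *m _ *m B]mulmxA -/B1 cE; congr (_ *m _).
  by rewrite /S map_block_mx (mul_row_block c0) map_mx1 mulmx1 map_mx0 mulmx0 add0r.
set E := enorm _.
have E0 : 0 <= E by exact: enorm_ge0.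
have E2 := pyth (c0 + c' *m map_mx intr (\col_i s i)) (c' *m map_mx intr U').
rewrite -/E in E2; set t := fun_of_matrix _ 0 0 in E2.
have tE : `|t| * lam <= E.
  apply: (@le_trans _ _ (`|t| * enorm b)); first by rewrite ler_wpM2l.
  rewrite -(@ler_pXn2r _ 2)// ?nnegrE ?mulr_ge0 ?enorm_ge0// E2 exprMn.
  by rewrite real_normK ?num_real// -exprMn lerDl sqr_ge0.
(* The factor 2 pays for the minimum lam / 2 in the induction hypothesis. *)
have c'E j : `|c' 0 j| * lam <= 2 * d`!%:R * E.
  have : enorm (c' *m map_mx intr U' *m B2) <= E.
    by rewrite -(@ler_pXn2r _ 2)// ?nnegrE ?enorm_ge0// E2 lerDr sqr_ge0.
  move/(ler_wpM2l (ler0n R (d`!))); have := redU' c' j; lra.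
rewrite cE; case: (split_ordP (i : 'I_(1 + d))) => j ->.
  rewrite (row_mxEl c0 c' 0 j) ord1.
  have c0E : c0 0 0 = t - \sum_j c' 0 j * ((s j)%:~R + (map_mx intr U' *m p) j 0).
    have -> : t = c0 0 0 + ((c' *m map_mx intr (\col_i s i)) 0 0 + (c' *m (map_mx intr U' *m p)) 0 0).
      by rewrite mulmxA addrA /t mxE; congr (_ + _); rewrite mxE.
    rewrite ![(c' *m _) 0 0]mxE -big_split/= [X in _ + X - _](eq_bigr
      (fun j => c' 0 j * ((s j)%:~R + (map_mx intr U' *m p) j 0))) ?addrK// => k _.
    by rewrite mulrDr !mxE.
  have : `|c0 0 0| <= `|t| + \sum_j `|c' 0 j| * 2^-1.
    rewrite c0E (le_trans (ler_normB _ _))// lerD2l (le_trans (ler_norm_sum _ _ _))//.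
    by apply: ler_sum => k _; rewrite normrM ler_wpM2l.
  move/(ler_wpM2r (ltW lam0)) => /le_trans; apply.
  rewrite mulrDl mulr_suml.
  (* Each of the [d] terms is at most (1/2) 2 d! E, and 1 + d d! <= (d + 1)!. *)
  apply: (@le_trans _ _ (E + \sum_(k < d) d`!%:R * E)).
    by rewrite lerD//; apply: ler_sum => k _; have := c'E k; lra.
  rewrite sumr_const card_ord -[X in _ + X]mulr_natl mulrA -[X in X + _]mul1r -mulrDl.
  rewrite ler_wpM2r// -natrM -(natrD _ 1) ler_nat factS mulSn leq_add2r.
  exact: fact_gt0.
rewrite (row_mxEr c0 c' 0 j); apply: le_trans (c'E j) _; rewrite ler_wpM2r// -natrM ler_nat factS.
by rewrite leq_mul2r ltnS (leq_ltn_trans _ (ltn_ord j)) ?orbT.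
Qed.
End ReducedBasis.

(** * Moebius inversion *)

Definition moebius (n : nat) : int :=
  if all (fun p => logn p n == 1%N) (primes n) then (-1) ^+ size (primes n) else 0.

Lemma norm_moebius_le1 n : `|moebius n| <= 1.
Proof. by rewrite /moebius; case: ifP => _; rewrite ?normr0// normrX normrN1 expr1n. Qed.

Lemma moebius_dvd p e : prime p -> (0 < e)%N -> (p %| e)%N -> moebius (p * e) = 0.
Proof.
move=> pp e0 pe; rewrite /moebius ifF//; apply/negP => /allP/(_ p).
have p0 := prime_gt0 pp.
rewrite mem_primes pp muln_gt0 p0 e0 dvdn_mulr// lognM// logn_prime// eqxx.
have : (0 < logn p e)%N by rewrite logn_gt0 mem_primes pp e0.
by case: (logn p e) => // k _ /(_ isT).
Qed.

Lemma moebius_prime p e : prime p -> (0 < e)%N -> ~~ (p %| e)%N ->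
  moebius (p * e) = - moebius e.
Proof.
move=> pp e0 pe; have p0 := prime_gt0 pp.
have pP : perm_eq (primes (p * e)) (p :: primes e).
  apply: uniq_perm => [||q]; rewrite ?primes_uniq//=.
    by rewrite primes_uniq mem_primes pp e0 (negPf pe).
  by rewrite primesM// inE primes_prime// inE.
rewrite /moebius (perm_all _ pP) (perm_size pP) /= lognM// logn_prime// eqxx.
have /negPf l0 : ~~ (0 < logn p e)%N by rewrite logn_gt0 mem_primes pp e0 (negPf pe).
have -> : logn p e = 0%N by move: l0; case: (logn p e).
rewrite eqxx /= (@eq_in_all _ _ (fun q => logn q e == 1%N)).
  by case: ifP => _; rewrite ?oppr0// exprS mulN1r.
move=> q; rewrite mem_primes => /and3P[qp _ qe].
rewrite lognM// logn_prime// (_ : (q == p) = false)//.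
by apply: contraNF pe => /eqP <-.
Qed.

(* For a prime [p] dividing [n], the divisors [e] and [p * e] with [p] not dividing
   [e] cancel. *)
Lemma sum_moebius n : (0 < n)%N -> \sum_(k <- divisors n) moebius k = (n == 1%N)%:R.
Proof.
move=> n0; have [->|n1] := eqVneq n 1%N; first by rewrite big_seq1.
have n2 : (1 < n)%N by rewrite ltn_neqAle eq_sym n1.
pose p := pdiv n; have pp : prime p := pdiv_prime n2.
have p0 := prime_gt0 pp.
pose n' := (n %/ p)%N; have nE : n = (p * n')%N by rewrite mulnC divnK// pdiv_dvd.
have n'0 : (0 < n')%N by move: n0; rewrite nE muln_gt0 => /andP[].
rewrite (bigID (fun k => p %| k)%N)/= -big_filter.
rewrite (perm_big [seq (p * e)%N | e <- divisors n']); last first.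
  apply: uniq_perm; rewrite ?filter_uniq ?divisors_uniq// ?map_inj_uniq ?divisors_uniq//.
    by move=> x y /eqP; rewrite eqn_pmul2l// => /eqP.
  move=> k; rewrite mem_filter -dvdn_divisors//; apply/andP/mapP => [[/dvdnP[e ->]]|[e]].
    by rewrite nE mulnC dvdn_pmul2l// => en; exists e; rewrite // -dvdn_divisors.
  by rewrite -dvdn_divisors// => en ->; rewrite dvdn_mulr// nE dvdn_pmul2l.
rewrite big_map (bigID (fun e => p %| e)%N)/= big_seq_cond big1 ?add0r; last first.
  by move=> e /andP[+ pe]; rewrite -dvdn_divisors// => /(dvdn_gt0 n'0) e0; rewrite moebius_dvd.
rewrite big_seq_cond (eq_bigr (fun e => - moebius e)); last first.
  by move=> e /andP[+ pe]; rewrite -dvdn_divisors// => /(dvdn_gt0 n'0) e0; rewrite moebius_prime.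
rewrite -big_seq_cond sumrN -[X in - X]big_filter -[X in _ + X]big_filter.
rewrite (@perm_big _ _ _ _ _ [seq e <- divisors n | ~~ (p %| e)%N]) ?addNr//.
apply: uniq_perm; rewrite ?filter_uniq ?divisors_uniq// => e.
rewrite !mem_filter -!dvdn_divisors//; case: (boolP (p %| e)%N) => //= pe.
by rewrite nE Gauss_dvdr// coprime_sym prime_coprime.
Qed.

Lemma big_dvdn_range (V : nmodType) (F : nat -> V) k K : (0 < k)%N ->
  \sum_(1 <= n < K.+1 | (k %| n)%N) F n = \sum_(1 <= j < (K %/ k).+1) F (k * j)%N.
Proof.
move=> k0; rewrite -big_filter -(big_map (muln k) xpredT F); apply: perm_big.
apply: uniq_perm; rewrite ?filter_uniq ?iota_uniq// ?map_inj_uniq ?iota_uniq//.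
  by move=> x y /eqP; rewrite eqn_pmul2l// => /eqP.
move=> n; rewrite mem_filter mem_index_iota; apply/andP/mapP => [[/dvdnP[j ->]]|[j]].
  rewrite muln_gt0 k0 andbT ltnS => /andP[j0 jK]; exists j; last by rewrite mulnC.
  by rewrite mem_index_iota j0 ltnS leq_divRL.
rewrite mem_index_iota ltnS leq_divRL// => /andP[j0 jK] ->.
by rewrite dvdn_mulr// muln_gt0 k0 j0 ltnS mulnC.
Qed.

Lemma sum_moebius_range n m : (0 < n <= m)%N ->
  \sum_(1 <= k < m.+1 | (k %| n)%N) moebius k = (n == 1%N)%:R.
Proof.
move=> /andP[n0 nm]; rewrite -sum_moebius// -big_filter; apply: perm_big.
apply: uniq_perm; rewrite ?filter_uniq ?iota_uniq// ?divisors_uniq// => k.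
rewrite mem_filter mem_index_iota -dvdn_divisors//; case: (boolP (k %| n)%N) => //= kn.
by rewrite (dvdn_gt0 n0 kn) ltnS (leq_trans (dvdn_leq n0 kn)).
Qed.

(** * Partial sums of the zeta and harmonic series *)

Section Zeta.
Variable R : realType.

Definition zeta_sum (N m : nat) : R := \sum_(1 <= j < m.+1) (j%:R ^+ N)^-1.
Definition harmonic_sum (m : nat) : R := \sum_(1 <= j < m.+1) j%:R^-1.

(** The termwise bound 1/(q+1)^N <= 1/q^(N-1) - 1/(q+1)^(N-1) telescopes. With u = 1/q and v =
    1/(q+1) it rests on u - v = u v. *)
Lemma zeta_sum_telescope N m l : (1 < N)%N -> (0 < m)%N ->
  zeta_sum N (m + l) <= zeta_sum N m + ((m%:R ^+ N.-1)^-1 - ((m + l)%:R ^+ N.-1)^-1).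
Proof.
move=> N1 m0; elim: l => [|l IH]; first by rewrite addn0 subrr addr0.
rewrite addnS [X in X <= _]/zeta_sum big_nat_recr//= -/(zeta_sum N (m + l)).
suff H : ((m + l).+1%:R ^+ N)^-1 <=
    ((m + l)%:R ^+ N.-1)^-1 - ((m + l).+1%:R ^+ N.-1)^-1 :> R by lra.
have q0 : (0 < m + l)%N by rewrite addn_gt0 m0.
move: (m + l)%N q0 => q q0; case: N N1 {IH} => [|[|N]]// _ /=.
have x0 : 0 < q%:R :> R by rewrite ltr0n.
have y0 : 0 < q.+1%:R :> R by rewrite ltr0n.
have xy : q.+1%:R = q%:R + 1 :> R by rewrite natr1.
have x1 : 1 <= q%:R :> R by rewrite (ler_nat R 1).
set y : R := q.+1%:R in y0 xy *; set x : R := q%:R in x0 xy x1 *.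
rewrite -!exprVn; set u := x^-1; set v := y^-1.
have v0 : 0 < v by rewrite invr_gt0.
have vu : v <= u by rewrite lef_pV2 ?posrE// xy lerDl.
have uv : u - v = u * v.
  by rewrite /u /v xy; field; rewrite -xy !gt_eqF.
have : v ^+ N <= u ^+ N by rewrite lerXn2r// nnegrE ltW// (lt_le_trans v0).
move=> vuN; rewrite !exprS.
apply: (@le_trans _ _ (v ^+ N * (u - v))).
  have -> : v ^+ N * (u - v) = v * v ^+ N * u by rewrite uv; ring.
  have -> : v * (v * v ^+ N) = v * v ^+ N * v by ring.
  by rewrite ler_wpM2l// mulr_ge0 ?exprn_ge0// ltW.
have : v ^+ N * u <= u ^+ N * u by rewrite ler_wpM2r// (le_trans (ltW v0)).
by rewrite mulrBr ![_ * v ^+ N]mulrC [_ * u ^+ N]mulrC; lra.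
Qed.

(** The telescoped bound also gives convergence, so the limit defining [zeta] is the genuine sum of
    the series. *)
Lemma zeta_bounds N m : (1 < N)%N -> (0 < m)%N ->
  zeta_sum N m <= zeta (N%:R : R) <= zeta_sum N m + (m%:R ^+ N.-1)^-1.
Proof.
move=> N1 m0.
have sE n : series (riemannR (N%:R : R)) n = zeta_sum N n.
  rewrite /zeta_sum big_add1; apply: eq_bigr => i _.
  by rewrite /riemannR powR_mulrn.
have nd : nondecreasing_seq (series (riemannR (N%:R : R))).
  by apply: nondecreasing_series => n _; rewrite invr_ge0 powR_ge0.
have ub n : series (riemannR (N%:R : R)) n <= zeta_sum N m + (m%:R ^+ N.-1)^-1.
  apply: (@le_trans _ _ (series (riemannR (N%:R : R)) (m + n))).
    by apply: nd; rewrite leq_addl.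
  rewrite sE; apply: le_trans (zeta_sum_telescope _ _ _) _ => //.
  by rewrite lerD2l gerBl invr_ge0 exprn_ge0.
have cv : cvgn (series (riemannR (N%:R : R))).
  apply: nondecreasing_is_cvgn => //.
  by exists (zeta_sum N m + (m%:R ^+ N.-1)^-1) => _ [n _ <-].
apply/andP; split; last by apply: limr_le => //; apply: nearW.
by rewrite -sE; apply: nondecreasing_cvgn_le.
Qed.

(* The finite form of [zeta(N) * sum_k moebius k / k^N = 1]: group the terms by
   [n = k * j <= K] and sum over the divisors [k] of [n]. *)
Lemma moebius_zeta_sum N K : (0 < K)%N ->
  \sum_(1 <= k < K.+1) (moebius k)%:~R * (k%:R ^+ N)^-1 * zeta_sum N (K %/ k) = 1.
Proof.
move=> K0; transitivity (\sum_(1 <= n < K.+1) (n%:R ^+ N)^-1 *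
    (\sum_(1 <= k < K.+1 | (k %| n)%N) moebius k)%:~R : R); last first.
  rewrite big_ltn// sum_moebius_range// eqxx expr1n invr1 mulr1.
  rewrite big_nat_cond big1 ?addr0// => n /andP[/andP[n1 nK] _].
  by rewrite sum_moebius_range ?(ltnW n1)//= gtn_eqF// mulr0.
under [RHS]eq_bigr do rewrite rmorph_sum /= mulr_sumr.
rewrite (exchange_big_dep xpredT)//= big_nat_cond [RHS]big_nat_cond.
apply: eq_bigr => k /andP[/andP[k0 kK] _].
rewrite big_dvdn_range// /zeta_sum mulr_sumr; apply: eq_bigr => j _.
by rewrite natrM exprMn invfM [RHS]mulrC mulrA.
Qed.

(** By the finite identity, the error times zeta(N) is minus the sum of moebius k / k^N times a tail
    of zeta(N) beyond floor(K/k), up to sign. As floor(K/k) >= K/(2k), that tail is at most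
    (2k/K)^(N-1), so each term is at most (2/K)^(N-1) / k. Since zeta(N) >= 1, dividing by it only
    helps. *)
Lemma moebius_zeta N K : (1 < N)%N -> (0 < K)%N ->
  `|\sum_(1 <= k < K.+1) (moebius k)%:~R * (k%:R ^+ N)^-1 - (zeta N%:R)^-1| <=
  (2 / K%:R) ^+ N.-1 * harmonic_sum K.
Proof.
move=> N1 K0; set s := \sum_(_ <= _ < _) _; set zt := zeta _.
have zt1 : 1 <= zt.
  have /andP[+ _] := zeta_bounds N1 (ltnSn 0).
  by rewrite /zeta_sum big_nat1 expr1n invr1.
have zt0 : 0 < zt by exact: lt_le_trans zt1.
have K0' : 0 < K%:R :> R by rewrite ltr0n.
have E : s * zt - 1 = \sum_(1 <= k < K.+1)
    (moebius k)%:~R * (k%:R ^+ N)^-1 * (zt - zeta_sum N (K %/ k)).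
  rewrite -[X in _ - X = _](moebius_zeta_sum N K0) mulr_suml -sumrB; apply: eq_bigr => k _.
  by rewrite mulrBr.
have -> : s - zt^-1 = (s * zt - 1) / zt.
  by rewrite mulrBl mulfK ?gt_eqF// mul1r.
rewrite normrM (ger0_norm (ltW _ : 0 <= zt^-1)) ?invr_gt0//.
apply: (@le_trans _ _ `|s * zt - 1|).
  by rewrite ler_piMr// invf_le1.
rewrite E; apply: le_trans (ler_norm_sum _ _ _) _.
rewrite /harmonic_sum mulr_sumr big_nat_cond [leRHS]big_nat_cond.
apply: ler_sum => k /andP[/andP[k0 kK] _].
have k0' : 0 < k%:R :> R by rewrite ltr0n.
have q0 : (0 < K %/ k)%N by rewrite divn_gt0.
have /andP[z1 z2] := zeta_bounds N1 q0.
rewrite !normrM; apply: (@le_trans _ _ (1 * (k%:R ^+ N)^-1 * ((K %/ k)%:R ^+ N.-1)^-1)).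
  apply: ler_pM => //.
    rewrite [X in _ * X]ger0_norm ?invr_ge0 ?exprn_ge0// ler_wpM2r ?invr_ge0 ?exprn_ge0//.
    by rewrite -intr_norm (ler_int R _ 1) norm_moebius_le1.
  by rewrite ger0_norm ?subr_ge0// lerBlDl.
rewrite mul1r -(prednK (ltnW N1)) exprS invfM /= -mulrA mulrC.
rewrite ler_wpM2r ?invr_ge0 ?ler0n// -!exprVn -exprMn.
rewrite lerXn2r ?nnegrE ?mulr_ge0 ?invr_ge0 ?ler0n//.
rewrite -invfM -[X in _ <= X]invf_div lef_pV2 ?posrE ?mulr_gt0 ?invr_gt0 ?ltr0n//.
rewrite ler_pdivrMr// -!natrM ler_nat muln2 -addnn.
rewrite {1}(divn_eq K k) mulnC leq_add2l ltnW// (leq_trans (ltn_pmod K k0))//.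
exact: leq_pmulr.
Qed.

(** Every dyadic block from 2^i to 2^(i+1) - 1 contributes at most 1. The exponent [j] is returned
    instead of a logarithm because 2^j <= K links the bound to the divisors of 2^j. *)
Lemma harmonic_sum_le K : (0 < K)%N ->
  exists2 j : nat, (2 ^ j <= K)%N & harmonic_sum K <= j.+1%:R.
Proof.
move=> K0; exists (trunc_log 2 K); first by rewrite trunc_logP.
have := trunc_log_ltn K (ltnSn 1); move: (trunc_log 2 K) => j Kj.
have Hj : harmonic_sum (2 ^ j.+1).-1 <= j.+1%:R.
  elim: j {Kj} => [|j IH]; first by rewrite /harmonic_sum big_nat1 invr1.
  rewrite /harmonic_sum (big_cat_nat (n := (2 ^ j.+1)%N))/=; last 2 first.
  - by rewrite expn_gt0.
  - by rewrite prednK ?expn_gt0// leq_exp2l.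
  rewrite -natr1 lerD//.
    by move: IH; rewrite /harmonic_sum prednK ?expn_gt0.
  rewrite prednK ?expn_gt0//.
  apply: (@le_trans _ _ (\sum_(2 ^ j.+1 <= i < 2 ^ j.+2) (2 ^ j.+1)%:R^-1)).
    rewrite big_nat_cond [leRHS]big_nat_cond; apply: ler_sum => i /andP[/andP[h1 h2] _].
    rewrite lef_pV2 ?posrE ?ltr0n ?ler_nat ?expn_gt0//.
    by apply: leq_trans h1; rewrite expn_gt0.
  rewrite sumr_const_nat -[leLHS]mulr_natl [(2 ^ j.+2)%N]expnS mul2n -addnn addnK.
  by rewrite mulfV// pnatr_eq0 expn_eq0.
apply: le_trans Hj; rewrite /harmonic_sum prednK ?expn_gt0//.
rewrite [leRHS](big_cat_nat (n := K.+1))//= lerDl.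
by apply: sumr_ge0 => i _; rewrite invr_ge0.
Qed.

Lemma size_divisors_expn2 j : (j < size (divisors (2 ^ j)))%N.
Proof.
have : (size [seq (2 ^ i)%N | i <- iota 0 j.+1] <= size (divisors (2 ^ j)))%N.
  apply: uniq_leq_size => [|_ /mapP[i + ->]].
    by rewrite map_inj_uniq ?iota_uniq// => x y /eqP; rewrite eqn_exp2l// => /eqP.
  by rewrite mem_iota add0n ltnS -dvdn_divisors ?expn_gt0// => /andP[_ ij]; exact: dvdn_exp2l.
by rewrite size_map size_iota.
Qed.

Lemma sum_inv_sqr K : (0 < K)%N ->
  \sum_(1 <= k < K.+1) (k%:R ^+ 2)^-1 <= 2 :> R.
Proof.
move=> K0; have := @zeta_sum_telescope 2 1 K.-1 isT isT.
rewrite add1n prednK// /zeta_sum big_nat1 !expr1n !invr1 /=.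
have : 0 <= (K%:R ^+ 1)^-1 :> R by rewrite invr_ge0.
move: (\sum_(_ <= _ < _) _) => x; lra.
Qed.

(** For d = 2 the sum is X times a harmonic sum; for d >= 3 the powers k^(1-d) are dominated by
    k^(-2). The bound adds the two cases. *)
Lemma sum_power_bound d K (X : R) : (1 < d)%N -> (0 < K)%N -> 1 <= X ->
  \sum_(1 <= k < K.+1) (X / k%:R) ^+ d.-1 <= 2 * X ^+ d.-1 + X * harmonic_sum K.
Proof.
move=> d1 K0 X1; have X0 : 0 <= X by apply: le_trans X1.
have h0 : 0 <= harmonic_sum K by apply: sumr_ge0 => k _; rewrite invr_ge0.
case: d d1 => [|[|[|d]]]// _ /=.
  rewrite /harmonic_sum mulr_sumr expr1.
  by under eq_bigr do rewrite expr1; rewrite lerDr mulr_ge0.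
apply: (@le_trans _ _ (2 * X ^+ d.+2)); last by rewrite lerDl mulr_ge0.
apply: (@le_trans _ _ (X ^+ d.+2 * \sum_(1 <= k < K.+1) (k%:R ^+ 2)^-1)); last first.
  by rewrite [leRHS]mulrC ler_wpM2l ?exprn_ge0// sum_inv_sqr.
rewrite mulr_sumr big_nat_cond [leRHS]big_nat_cond; apply: ler_sum => k /andP[/andP[k0 kK] _].
rewrite exprMn ler_wpM2l ?exprn_ge0// exprVn lef_pV2 ?posrE ?exprn_gt0 ?ltr0n//.
by rewrite ler_weXn2l// (ler_nat R 1).
Qed.
End Zeta.

(** * Primitive integer points *)

(** The value is 0 exactly at the zero vector, which is thus divisible by every [k] and never has
    gcd 1. *)
Definition gcdv (d : nat) (z : 'rV[int]_d) : nat := \big[gcdn/0%N]_j `|(z 0 j)%R|%N.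

Section GcdVector.
Variable d : nat.
Implicit Types z : 'rV[int]_d.

Lemma dvdn_gcdv k z : (k %| gcdv z)%N = [forall j, (k %| `|(z 0 j)%R|)%N].
Proof.
apply/idP/forallP => [kz j|kz]; first by rewrite (dvdn_trans kz)// /gcdv (bigD1 j)//= dvdn_gcdl.
by rewrite /gcdv; elim/big_ind: _ => // x y kx ky; rewrite dvdn_gcd kx.
Qed.

Lemma gcdv_gt0 z : (0 < gcdv z)%N = (z != 0).
Proof.
rewrite lt0n; congr (~~ _); apply/eqP/eqP => [z0|->].
  apply/rowP => j; have : (0 %| gcdv z)%N by rewrite z0.
  by rewrite dvdn_gcdv => /forallP/(_ j); rewrite dvd0n absz_eq0 mxE => /eqP.
by apply/eqP; rewrite -dvd0n dvdn_gcdv; apply/forallP => j; rewrite mxE.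
Qed.

Lemma dvdn_gcdvP (k : nat) z : reflect (exists z', z = k%:Z *: z') (k %| gcdv z)%N.
Proof.
rewrite dvdn_gcdv; apply: (iffP forallP) => [kz|[z' ->] j]; last first.
  by rewrite mxE abszM dvdn_mulr.
exists (\row_j ((z 0 j)%R %/ k%:Z)%Z); apply/rowP => j; rewrite !mxE mulrC divzK//.
by rewrite dvdzE /=.
Qed.

(** A finite list holding all points that will be counted, so that counts become sizes of filtered
    sequences. *)
Definition int_cube (B : nat) : seq 'rV[int]_d :=
  undup [seq \row_j ((q j : nat)%:Z - B%:Z) | q : {ffun 'I_d -> 'I_(B + B).+1}].

Lemma int_cube_uniq B : uniq (int_cube B). Proof. exact: undup_uniq. Qed.

Lemma mem_int_cube (R : realType) (B : nat) z (x : R) :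
  (forall j, `|(z 0 j)%:~R| <= x) -> x < B.+1%:R -> z \in int_cube B.
Proof.
move=> zx xB; rewrite mem_undup; apply/mapP.
have zB j : (`|(z 0 j)%R| <= B)%N.
  by have := le_lt_trans (zx j) xB; rewrite -intr_norm -abszE -pmulrn ltr_nat ltnS.
exists [ffun j => inord `|(z 0 j + B%:Z)%R|%N]; first by rewrite mem_enum.
have shift (u : int) : (`|u| <= B)%N ->
    u = `|(u + B%:Z)%R|%N%:Z - B%:Z /\ (`|(u + B%:Z)%R| < (B + B).+1)%N by lia.
by apply/rowP => j; have [E ?] := shift _ (zB j); rewrite mxE ffunE inordK.
Qed.
End GcdVector.

Lemma vol_scale (R : realType) (d : nat) (W : set 'rV[R]_d) (a : R) :
  (0 < d)%N -> 0 < a ->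
  vol [set (a *: x)%R | x in W] = ((a ^+ d)%:E * vol W)%E.
Proof.
move=> d0 a0; have -> : [set a *: x | x in W] = [set x *m a%:M | x in W].
  by apply: eq_imagel => x _; rewrite mul_mx_scalar.
rewrite vol_mulmx//; first by rewrite det_scalar ger0_norm// exprn_ge0// ltW.
by rewrite unitmxE det_scalar unitfE expf_neq0// gt_eqF.
Qed.

(** * Primitive integer points in a set with Lipschitz boundary *)

Section PrimitivePoints.
Variables (R : realType) (d M : nat) (L0 r0 : R).
Hypotheses (d1 : (1 < d)%N) (L00 : 0 <= L0) (r00 : 0 <= r0).
Variables (W : set 'rV[R]_d) (y : 'rV[R]_d) (X H : R).
Hypotheses (X1 : 1 <= X) (XH : X <= H).
Hypothesis Wy : forall c, W c -> forall j, `|c 0 j - y 0 j| <= r0 * X.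
Hypothesis WH : forall c, W c -> forall j, `|c 0 j| <= H.
Hypothesis LipW : forall k : nat, (0 < k)%N ->
  Lip M (L0 * X / k%:R) (bdry [set (k%:R^-1 *: x)%R | x in W]).

Let d0 : (0 < d)%N := ltnW d1.
Let X0 : 0 <= X := le_trans ler01 X1.
Let H0 : 0 <= H := le_trans X0 XH.
(** The margin of 1 beyond H makes room for corners of unit cubes that meet W / k without having
    their corner in it. *)
Let S := int_cube d (Num.truncn H).+1.
(** [n k] counts W \cap k Z^d with the origin, as the volume comparison requires. [m k] omits the
    origin, which every [k] divides and which Moebius inversion could not remove. *)
Let n (k : nat) := size [seq z <- S | `[< W (k%:R *: zr R z) >]].
Let m (k : nat) := size [seq z <- S | [&& `[< W (zr R z) >], z != 0 & (k %| gcdv z)%N]].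
Let V := fine (vol W).

Let boundary_const := M%:R * (d%:R * (L0 + 1)) ^+ d.-1 * 4 ^+ d : R.

Lemma mem_S (z : 'rV[int]_d) (x : R) :
  (forall j, `|(z 0 j)%:~R| <= x) -> x <= H + 1 -> z \in S.
Proof.
move=> zx xH; apply: mem_int_cube zx _; apply: le_lt_trans xH _.
by rewrite -[ltRHS]natr1 ltrD2r truncnS_gt.
Qed.

Lemma vol_le_boxed : (vol W <= ((2 * r0 * X) ^+ d)%:E)%E.
Proof.
apply: (@le_trans _ _ (vol (box (y - const_mx (r0 * X)) (y + const_mx (r0 * X))))).
  apply: le_vol => c Wc j; have := Wy Wc j; rewrite !mxE ler_norml => /andP[]; lra.
apply: le_trans (vol_box d0 _) _.
  by move=> j; rewrite !mxE; have := mulr_ge0 r00 X0; lra.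
rewrite lee_fin /boxvol -[X in _ ^+ X]card_ord -prodr_const; apply: ler_prod => j _.
rewrite !mxE; have := mulr_ge0 r00 X0; lra.
Qed.

Lemma fin_vol_boxed : vol W \is a fin_num.
Proof. by rewrite ge0_fin_numE ?vol_ge0// (le_lt_trans vol_le_boxed) ?ltry. Qed.

Lemma V_ge0 : 0 <= V. Proof. by rewrite fine_ge0// vol_ge0. Qed.

Lemma V_le : V <= (2 * r0 * X) ^+ d.
Proof. by rewrite -lee_fin fineK ?fin_vol_boxed// vol_le_boxed. Qed.

(** [lattice_count] applied to W / k. The condition k <= X absorbs the additive 1 of the cube count:
    L0 X / k + 1 <= (L0 + 1) X / k. *)
Lemma count_multiples (k : nat) : (0 < k)%N -> k%:R <= X ->
  `|(n k)%:R - V / k%:R ^+ d| <= boundary_const * (X / k%:R) ^+ d.-1.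
Proof.
move=> k0 kX; have k0' : 0 < k%:R :> R by rewrite ltr0n.
have k1 : 1 <= k%:R :> R by rewrite (ler_nat R 1).
pose Wk := [set k%:R^-1 *: x | x in W].
have WkE (x : 'rV[R]_d) : Wk x <-> W (k%:R *: x).
  split=> [[w Ww <-]|Wx]; first by rewrite scalerA mulfV ?gt_eqF// scale1r.
  by exists (k%:R *: x) => //; rewrite scalerA mulVf ?gt_eqF// scale1r.
have near z x : ucell z x -> Wk x -> z \in S.
  move=> zx /WkE/WH Wx; apply: (@mem_S _ (H + 1)) => // j.
  have := zx j; have := Wx j; rewrite !mxE.
  have xk : `|x 0 j| <= `|k%:R * x 0 j|.
    by rewrite normrM ger0_norm ?(ltW k0')// ler_peMl.
  move=> /(le_trans xk); rewrite !ler_norml => /andP[h1 h2] /andP[h3 h4].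
  by apply/andP; split; lra.
have := @lattice_count R d Wk S d0 (int_cube_uniq _ _) near.
rewrite vol_scale ?invr_gt0// fineM ?fin_vol_boxed//= -/V mulrC exprVn.
have -> : [seq z <- S | `[< Wk (zr R z) >]] = [seq z <- S | `[< W (k%:R *: zr R z) >]].
  by apply: eq_filter => z; apply: asbool_equiv_eq; exact: WkE.
move=> /le_trans; apply.
apply: le_trans (size_bdry_cells _ (LipW k0) _ _) _.
- by rewrite mulr_ge0 ?mulr_ge0 ?invr_ge0.
- by rewrite filter_uniq// int_cube_uniq.
- by move=> z; rewrite mem_filter => /andP[/asboolP].
rewrite /boundary_const [leRHS]mulrAC ler_wpM2r ?exprn_ge0// -[leRHS]mulrA ler_wpM2l//.
rewrite -exprMn lerXn2r ?nnegrE ?mulr_ge0 ?addr_ge0 ?mulr_ge0 ?invr_ge0//.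
rewrite -!mulrA ler_wpM2l// mulrDl mul1r lerD2l.
by rewrite ler_pdivlMr// mul1r.
Qed.

Lemma count_multiples_small (k : nat) : (0 < k)%N -> X <= k%:R ->
  (n k)%:R <= (2 * r0 + 1) ^+ d.
Proof.
move=> k0 Xk; have k0' : 0 < k%:R :> R by rewrite ltr0n.
have rk : r0 * X / k%:R <= r0.
  by rewrite ler_pdivrMr// ler_wpM2l.
have rk0 : 0 <= r0 * X / k%:R by rewrite !mulr_ge0 ?invr_ge0.
apply: le_trans (@size_int_box R d (k%:R^-1 *: y - const_mx (r0 * X / k%:R))
  (k%:R^-1 *: y + const_mx (r0 * X / k%:R)) _ _ _ _) _.
- by move=> j; rewrite !mxE; lra.
- by rewrite filter_uniq// int_cube_uniq.
- move=> z; rewrite mem_filter => /andP[/asboolP/Wy Wz _] j.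
  have := Wz j; rewrite !mxE; set w : R := (z 0 j)%:~R.
  have -> : k%:R * w - y 0 j = k%:R * (w - k%:R^-1 * y 0 j).
    by rewrite mulrBr mulrA mulfV ?gt_eqF// mul1r.
  rewrite normrM ger0_norm ?(ltW k0')// mulrC -ler_pdivlMr// ler_norml; lra.
rewrite -[X in _ ^+ X]card_ord -prodr_const; apply: ler_prod => j _.
rewrite !mxE; apply/andP; split; lra.
Qed.

(** Multiplication by [k] matches the nonzero points of the two counts; the boolean accounts for the
    origin. *)
Lemma n_m (k : nat) : (0 < k)%N -> n k = (`[< W 0%R >] + m k)%N.
Proof.
move=> k0; have k0' : 1 <= k%:R :> R by rewrite (ler_nat R 1).
have kN : k%:Z != 0 by rewrite eqz_nat -lt0n.
have zrk (z : 'rV[int]_d) : zr R (k%:Z *: z) = k%:R *: zr R z.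
  by apply/rowP => j; rewrite !mxE intrM -pmulrn.
have zr0 : zr R (0 : 'rV[int]_d) = 0 by apply/rowP => j; rewrite !mxE.
have S0 : 0 \in S by apply: (@mem_S _ 0) => [j|]; rewrite ?mxE ?normr0// addr_ge0.
have inS (z : 'rV[int]_d) : W (zr R z) -> z \in S.
  by move=> /WH Wz; apply: mem_S (H) _ _ => [j|]; [have := Wz j; rewrite mxE|rewrite lerDl].
rewrite /n size_filter -sum1_count big_mkcond (bigD1_seq 0)//= ?int_cube_uniq//.
congr (_ + _)%N; first by rewrite zr0 scaler0; case: asboolP.
rewrite -big_mkcondr sum1_count -size_filter /m.
rewrite -(size_map (fun z : 'rV[int]_d => k%:Z *: z)); apply: perm_size.
have inj : injective (fun z : 'rV[int]_d => k%:Z *: z).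
  move=> z z' /rowP zz; apply/rowP => j; have := zz j; rewrite !mxE.
  exact: mulfI.
have scE (z : 'rV[int]_d) : (k%:Z *: z == 0) = (z == 0).
  by rewrite -[X in _ == X = _](scaler0 _ k%:Z) (inj_eq inj).
apply: uniq_perm; rewrite ?map_inj_uniq ?filter_uniq ?int_cube_uniq// => z.
apply/mapP/idP => [[z']|]; rewrite mem_filter.
  move=> /andP[/andP[z'0 /asboolP Wz'] z'S] ->; rewrite mem_filter zrk.
  rewrite inS ?zrk// andbT scE (negPf z'0)/= asboolT//=.
  by apply/dvdn_gcdvP; exists z'.
move=> /andP[/and3P[/asboolP Wz z0 /dvdn_gcdvP[z' zE]] _]; exists z' => //.
move: Wz z0; rewrite zE zrk scE => Wz z'0.
rewrite mem_filter z'0 asboolT//=; apply: mem_S (H) _ _ => [j|]; last by rewrite lerDl.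
have := WH Wz j; rewrite !mxE normrM ger0_norm//; apply: le_trans.
by rewrite ler_peMl.
Qed.

Variable T : R -> R.
Hypothesis T1 : forall u, 0 <= u -> 1 <= T u.
Hypothesis Tle : forall u v, 0 <= u -> u <= v -> T u <= T v.
Hypothesis Tdiv : forall k : nat, (0 < k)%N -> (size (divisors k))%:R <= T k%:R.

Let K := Num.truncn X.
Let P := [seq z <- S | `[< W (zr R z) >] && (z != 0)].

Let K0 : (0 < K)%N. Proof. by rewrite truncn_gt0. Qed.
Let KX : K%:R <= X. Proof. by rewrite truncn_le. Qed.
Let XK : X < K.+1%:R. Proof. exact: truncnS_gt. Qed.
Let KH : (K <= Num.truncn H)%N. Proof. exact: le_truncn. Qed.
Let TH0 : 0 <= T H. Proof. exact: le_trans ler01 (T1 H0). Qed.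

Lemma m_P k : m k = size [seq z <- P | (k %| gcdv z)%N].
Proof. by rewrite -filter_predI; congr size; apply: eq_filter => z /=; rewrite [RHS]andbC andbA. Qed.

(* [T] grows at least logarithmically because [2 ^ j] has [j.+1] divisors. *)
Lemma harmonic_sum_le_T : harmonic_sum R K <= T H.
Proof.
have [j jK /le_trans] := harmonic_sum_le R K0; apply.
apply: (@le_trans _ _ (T (2 ^ j)%:R)).
  by apply: le_trans (Tdiv _); rewrite ?expn_gt0// ler_nat size_divisors_expn2.
by apply: Tle => //; rewrite (le_trans _ XH)// (le_trans _ KX)// ler_nat.
Qed.

(** The gcd of a nonzero point of W divides a nonzero coordinate and so is at most H. Hence the
    range of [k] contains all its divisors, and their Moebius sum detects gcd 1. *)
Lemma prim_moebius (s : seq 'rV[int]_d) : uniq s ->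
  (forall z, z \in s <-> W (zr R z) /\ gcdv z = 1%N) ->
  (size s)%:R = \sum_(1 <= k < (Num.truncn H).+1) (moebius k)%:~R * (m k)%:R :> R.
Proof.
move=> us sP.
have sE : perm_eq s [seq z <- P | gcdv z == 1%N].
  apply: uniq_perm; rewrite ?filter_uniq ?int_cube_uniq// => z.
  rewrite !mem_filter; apply/idP/idP => [/sP[Wz gz]|].
    rewrite gz eqxx asboolT//= -gcdv_gt0 gz /=.
    by apply: mem_S (H) _ _ => [j|]; [have := WH Wz j; rewrite mxE|rewrite lerDl].
  by move=> /and3P[/eqP gz /andP[/asboolP Wz _] _]; apply/sP.
rewrite (perm_size sE) -sum1_size big_filter natr_sum big_mkcond/=.
transitivity (\sum_(z <- P) \sum_(1 <= k < (Num.truncn H).+1 | (k %| gcdv z)%N)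
    (moebius k)%:~R : R).
  rewrite big_seq [RHS]big_seq; apply: eq_bigr => z.
  rewrite mem_filter => /andP[/andP[/asboolP Wz z0] _].
  rewrite -rmorph_sum/= sum_moebius_range; first by case: eqP.
  rewrite gcdv_gt0 z0 /=.
  have [j zj] := rV_neq0 z0.
  have := WH Wz j; rewrite mxE truncn_ge_nat// => zH; apply: le_trans zH.
  apply: (@le_trans _ _ (`|(z 0 j)%R|%N%:R)); last by rewrite -intr_norm -abszE -pmulrn.
  rewrite ler_nat dvdn_leq ?absz_gt0//.
  by have := dvdnn (gcdv z); rewrite dvdn_gcdv => /forallP/(_ j).
rewrite (exchange_big_dep xpredT)//=; apply: eq_bigr => k _.
by rewrite m_P size_filter -sum1_count natr_sum mulr_sumr; under [RHS]eq_bigr do rewrite mulr1.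
Qed.

Let J (j : 'I_d) := undup [seq z 0 j | z : 'rV[int]_d <- P & z 0 j != 0].

Lemma mem_J j b : b \in J j ->
  [/\ b != 0, `|b%:~R - y 0 j| <= r0 * X & `|b%:~R| <= H].
Proof.
rewrite mem_undup => /mapP[z]; rewrite mem_filter => /andP[zj].
rewrite mem_filter => /andP[/andP[/asboolP Wz _] _] ->; split=> //.
  by have := Wy Wz j; rewrite mxE.
by have := WH Wz j; rewrite mxE.
Qed.

Lemma size_J j : (size (J j))%:R <= (2 * r0 + 1) * X.
Proof.
have rX := mulr_ge0 r00 X0.
rewrite -(size_map (fun b => const_mx b : 'rV[int]_1)).
apply: le_trans (@size_int_box R 1 (const_mx (y 0 j - r0 * X)) (const_mx (y 0 j + r0 * X)) _ _ _ _) _.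
- by move=> i; rewrite !mxE; lra.
- by rewrite map_inj_uniq ?undup_uniq// => b b' /rowP/(_ 0); rewrite !mxE.
- by move=> _ /mapP[b /mem_J[_ + _] ->] i; rewrite !mxE ler_norml => /andP[]; lra.
rewrite big_ord1 !mxE; move: X1; lra.
Qed.

(* A multiple counted by [m k] has a nonzero coordinate divisible by [k], and the
   [j]-th coordinates range over [J j]. *)
Lemma tail_bound :
  \sum_(K.+1 <= k < (Num.truncn H).+1) (m k)%:R <=
  (2 * r0 + 1) ^+ d * (d%:R * (2 * r0 + 1) * X * T H).
Proof.
have c0 : 0 <= (2 * r0 + 1) ^+ d by rewrite exprn_ge0// addr_ge0// mulr_ge0.
apply: (@le_trans _ _ (\sum_(K.+1 <= k < (Num.truncn H).+1)
    (2 * r0 + 1) ^+ d * \sum_j \sum_(b <- J j) (k %| `|b|)%N%:R)).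
  rewrite big_nat_cond [leRHS]big_nat_cond; apply: ler_sum => k /andP[/andP[Kk _] _].
  have k0 : (0 < k)%N by exact: leq_ltn_trans Kk.
  have [->|mk0] := eqVneq (m k) 0%N.
    by rewrite mulr_ge0// sumr_ge0// => j _; rewrite sumr_ge0.
  apply: (@le_trans _ _ ((2 * r0 + 1) ^+ d * 1)).
    rewrite mulr1; apply: le_trans (count_multiples_small k0 _).
      by rewrite n_m// ler_nat leq_addl.
    by rewrite ltW// (lt_le_trans XK)// ler_nat.
  rewrite ler_wpM2l//.
  have [z zP kz] : exists2 z, z \in P & (k %| gcdv z)%N.
    move: mk0; rewrite m_P size_filter -lt0n -has_count => /hasP[z zP kz].
    by exists z.
  have z0 : z != 0 by move: zP; rewrite mem_filter => /andP[/andP[]].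
  have [j zj] := rV_neq0 z0.
  have zJ : z 0 j \in J j.
    by rewrite mem_undup; apply/mapP; exists z => //; rewrite mem_filter zj.
  rewrite (bigD1 j)//= (bigD1_seq (z 0 j))//= ?undup_uniq//.
  move: kz; rewrite dvdn_gcdv => /forallP/(_ j) ->.
  by rewrite -addrA lerDl addr_ge0// sumr_ge0// => *; rewrite sumr_ge0.
rewrite -mulr_sumr ler_wpM2l// exchange_big/=.
apply: (@le_trans _ _ (\sum_(j < d) (2 * r0 + 1) * X * T H)); last first.
  by rewrite sumr_const card_ord -[leLHS]mulr_natl !mulrA.
apply: ler_sum => j _; rewrite exchange_big/=.
apply: (@le_trans _ _ (\sum_(b <- J j) T H)); last first.
  by rewrite big_const_seq count_predT iter_addr_0 -[leLHS]mulr_natl ler_wpM2r// size_J.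
(* A nonzero [b] with |b| <= H is divisible by at most T(|b|) <= T(H) of the [k]. *)
rewrite big_seq [leRHS]big_seq; apply: ler_sum => b /mem_J[b0 _ bH].
have b0' : (0 < `|b|)%N by rewrite absz_gt0.
apply: (@le_trans _ _ (size (divisors `|b|))%:R); last first.
  apply: le_trans (Tdiv b0') _; apply: Tle => //.
  by rewrite pmulrn abszE intr_norm.
rewrite -natr_sum ler_nat -(big_mkcond (fun k => k %| `|b|)%N (fun=> 1%N)) /=.
rewrite sum1_count -size_filter; apply: uniq_leq_size.
  by rewrite filter_uniq// iota_uniq.
by move=> k; rewrite mem_filter -dvdn_divisors// => /andP[].
Qed.

(** The three terms come from the origin, which costs at most 1 for each k <= X; from the boundary
    errors summed over [k]; and from replacing the truncated Moebius sum by 1/zeta(d). In the last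
    one V <= (2 r0 X)^d and X <= 2 K leave a single power of X. *)
Lemma head_bound :
  `|\sum_(1 <= k < K.+1) (moebius k)%:~R * (m k)%:R - V / zeta (d%:R : R)| <=
  X * T H + boundary_const * (2 * X ^+ d.-1 + X * T H) +
  (2 * r0) ^+ d * 4 ^+ d.-1 * (X * T H).
Proof.
have bc0 : 0 <= boundary_const by rewrite !mulr_ge0 ?exprn_ge0// mulr_ge0// addr_ge0.
pose sK := \sum_(1 <= k < K.+1) (moebius k)%:~R * (k%:R ^+ d)^-1 : R.
have -> : \sum_(1 <= k < K.+1) (moebius k)%:~R * (m k)%:R - V / zeta (d%:R : R) =
    \sum_(1 <= k < K.+1) (moebius k)%:~R * ((m k)%:R - V / k%:R ^+ d) +
    V * (sK - (zeta (d%:R : R))^-1).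
  rewrite mulrBr addrA /sK mulr_sumr -big_split/=; congr (_ - _).
  by apply: eq_bigr => k _; ring.
apply: le_trans (ler_normD _ _) _; apply: lerD; last first.
  rewrite normrM (ger0_norm V_ge0).
  apply: le_trans (ler_pM V_ge0 (normr_ge0 _) V_le (moebius_zeta R d1 K0)) _.
  apply: (@le_trans _ _ ((2 * r0 * X) ^+ d * ((2 / K%:R) ^+ d.-1 * T H))).
    by rewrite !ler_wpM2l ?harmonic_sum_le_T ?exprn_ge0 ?mulr_ge0 ?divr_ge0.
  have K0' : 0 < K%:R :> R by rewrite ltr0n.
  have XK2 : X * (2 / K%:R) <= 4.
    rewrite mulrA ler_pdivrMr//; have : X <= K%:R + 1 by rewrite natr1 ltW.
    have : 1 <= K%:R :> R by rewrite (ler_nat R 1).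
    lra.
  rewrite exprMn -(prednK d0) [X ^+ _]exprS prednK//.
  have -> : (2 * r0) ^+ d * (X * X ^+ d.-1) * ((2 / K%:R) ^+ d.-1 * T H) =
      (2 * r0) ^+ d * (X * (2 / K%:R)) ^+ d.-1 * (X * T H).
    rewrite [(X * _) ^+ _]exprMn; move: (_ ^+ d) (X ^+ d.-1) ((2 / _) ^+ _) => a b c.
    by ring.
  rewrite ler_wpM2r ?mulr_ge0// ler_wpM2l ?exprn_ge0 ?mulr_ge0//.
  by rewrite lerXn2r ?nnegrE// mulr_ge0// divr_ge0.
apply: le_trans (ler_norm_sum _ _ _) _.
apply: (@le_trans _ _ (\sum_(1 <= k < K.+1) (1 + boundary_const * (X / k%:R) ^+ d.-1))).
  rewrite big_nat_cond [leRHS]big_nat_cond; apply: ler_sum => k /andP[/andP[k0 kK] _].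
  have kX : k%:R <= X by apply: le_trans KX; rewrite ler_nat.
  rewrite normrM -[leRHS]mul1r ler_pM//.
    by rewrite -intr_norm (ler_int R _ 1) norm_moebius_le1.
  have -> : (m k)%:R - V / k%:R ^+ d = ((n k)%:R - V / k%:R ^+ d) - `[< W 0 >]%:R :> R.
    by rewrite n_m// natrD; ring.
  rewrite (le_trans (ler_normB _ _))// addrC lerD ?count_multiples//.
  by rewrite normr_nat; case: asbool.
rewrite big_split/= -mulr_sumr lerD//.
  rewrite sumr_const_nat subSS subn0 -[X in X <= _]/(K%:R) (le_trans KX)//.
  by rewrite ler_peMr// T1.
rewrite ler_wpM2l//; apply: le_trans (sum_power_bound d1 K0 X1) _.
by rewrite lerD2l ler_wpM2l// harmonic_sum_le_T.
Qed.

Definition core_const : R :=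
  1 + boundary_const * 2 + boundary_const + (2 * r0) ^+ d * 4 ^+ d.-1 +
  (2 * r0 + 1) ^+ d * (d%:R * (2 * r0 + 1)).

Lemma primitive_count (s : seq 'rV[int]_d) : uniq s ->
  (forall z, z \in s <-> W (zr R z) /\ gcdv z = 1%N) ->
  `|(size s)%:R - V / zeta (d%:R : R)| <= core_const * (X ^+ d.-1 + X * T H).
Proof.
move=> us sP.
have bc0 : 0 <= boundary_const by rewrite !mulr_ge0 ?exprn_ge0// mulr_ge0// addr_ge0.
rewrite (prim_moebius us sP) (big_cat_nat (n := K.+1))//= addrAC.
apply: le_trans (ler_normD _ _) _; apply: le_trans (lerD head_bound _) _.
  apply: le_trans (ler_norm_sum _ _ _) _; apply: le_trans tail_bound.
  apply: ler_sum => k _; rewrite normrM normr_nat ler_piMl//.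
  by rewrite -intr_norm (ler_int R _ 1) norm_moebius_le1.
rewrite /core_const.
have A0 : 0 <= (2 * r0) ^+ d * 4 ^+ d.-1 by rewrite mulr_ge0 ?exprn_ge0 ?mulr_ge0.
have B0 : 0 <= (2 * r0 + 1) ^+ d * (d%:R * (2 * r0 + 1)).
  by rewrite !mulr_ge0 ?exprn_ge0// addr_ge0// mulr_ge0.
have u0 : 0 <= X ^+ d.-1 by rewrite exprn_ge0.
have v0 : 0 <= X * T H by rewrite mulr_ge0.
have -> : (2 * r0 + 1) ^+ d * (d%:R * (2 * r0 + 1) * X * T H) =
    (2 * r0 + 1) ^+ d * (d%:R * (2 * r0 + 1)) * (X * T H) by rewrite !mulrA.
move: ((2 * r0) ^+ d * 4 ^+ d.-1) A0 => A A0.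
move: ((2 * r0 + 1) ^+ d * (d%:R * (2 * r0 + 1))) B0 => B B0.
move: (X ^+ d.-1) u0 (X * T H) v0 boundary_const bc0 => u u0 v v0 b b0.
have := mulr_ge0 u0 (addr_ge0 (addr_ge0 b0 A0) B0); have := mulr_ge0 b0 v0.
by lra.
Qed.

End PrimitivePoints.

(** * Scaled lattices *)

Lemma counting_seq (R : realType) (T : choiceType) (t : seq T) : uniq t ->
  counting [set` t] = (size t)%:R%:E :> \bar R.
Proof.
move=> ut; have -> : [set` t] = [set` seq_fset tt t].
  by apply/seteqP; split=> x; rewrite /= (seq_fsetE tt t x).
rewrite /counting asboolT; last exact: finite_fset.
by rewrite set_fsetK size_seq_fset undup_id.
Qed.

(** * Blocks and block scalings *)

Section Blocks.
Variables (R : realType) (n : nat) (m : 'I_n -> nat).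
Implicit Types (x y : 'rV[R]_(\sum_i m i)) (s : 'I_n -> R).

Lemma enorm_blocks x : enorm x ^+ 2 = \sum_i enorm (submxrow x i) ^+ 2.
Proof.
rewrite enorm_sqr (reindex (@tagnat.rank n m)); last exact: tagnat.rank_bij_on.
under [RHS]eq_bigr do rewrite enorm_sqr.
rewrite (sig_big_dep xpredT (fun=> xpredT) (fun i j => submxrow x i 0 j ^+ 2)) /=.
by apply: eq_bigr => p _; rewrite tagnat.rankE mxE.
Qed.

(** With [s i = Qbar / Q i] this is the map phi of the statement; it turns balls of radius Q_i in
    the blocks into balls of the common radius Qbar. *)
Definition block_scale s : 'M[R]_(\sum_i m i) :=
  diag_mx (\row_k s (tagnat.sig1 k)).

Lemma submxrow_block_scale s x i :
  submxrow (x *m block_scale s) i = s i *: submxrow x i.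
Proof.
by apply/rowP => j; rewrite /block_scale mul_mx_diag !mxE tagnat.Rank1K mulrC.
Qed.

Lemma block_scale_unit s : (forall i, s i != 0) -> block_scale s \in unitmx.
Proof.
move=> s0; rewrite unitmxE det_diag unitfE; apply/prodf_neq0 => k _.
by rewrite mxE.
Qed.

Lemma enorm_submxrow_le x i : enorm (submxrow x i) <= enorm x.
Proof.
rewrite -(@ler_pXn2r _ 2)// ?nnegrE ?enorm_ge0// enorm_blocks.
by rewrite (bigD1 i)//= lerDl sumr_ge0// => *; exact: sqr_ge0.
Qed.

Lemma le_enorm_blocks x y :
  (forall i, enorm (submxrow x i) <= enorm (submxrow y i)) -> enorm x <= enorm y.
Proof.
move=> xy; rewrite -(@ler_pXn2r _ 2)// ?nnegrE ?enorm_ge0// !enorm_blocks.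
by apply: ler_sum => i _; rewrite ler_pXn2r ?nnegrE ?enorm_ge0.
Qed.
End Blocks.

(** A nonzero coordinate of [z] is at least 1 in absolute value and is obtained from z B by pairing
    with a column of the inverse of B. The bound depends on B and serves only to show that lambda_1
    is positive. *)
Lemma lattice_min_gt0 (R : realType) (d : nat) (B : 'M[R]_d) : B \in unitmx ->
  exists2 e : R, 0 < e & forall z : 'rV[int]_d, z != 0 -> e <= enorm (zr R z *m B).
Proof.
move=> uB; pose C := 1 + \sum_j \sum_k `|invmx B k j|.
have C0 : 0 < C by rewrite ltr_pwDl// sumr_ge0// => j _; rewrite sumr_ge0.
exists C^-1; first by rewrite invr_gt0.
move=> z z0.
have [j zj] := rV_neq0 z0.
have e0 := enorm_ge0 (zr R z *m B).
rewrite -[leRHS](mulfK (lt0r_neq0 C0)) -[leLHS]mul1r ler_wpM2r ?invr_ge0 ?(ltW C0)//.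
have : 1 <= `|zr R z 0 j|.
  by rewrite mxE -intr_norm (ler_int R 1) -gtz0_ge1 normr_gt0.
have -> : zr R z 0 j = (zr R z *m B *m invmx B) 0 j by rewrite mulmxK.
move/le_trans; apply; rewrite mxE.
apply: le_trans (ler_norm_sum _ _ _) _.
apply: (@le_trans _ _ (\sum_k enorm (zr R z *m B) * `|invmx B k j|)).
  by apply: ler_sum => k _; rewrite normrM ler_wpM2r// coord_le_enorm.
rewrite -mulr_sumr ler_wpM2l// /C [X in _ <= 1 + X](bigD1 j)//= addrCA lerDl addr_ge0//.
by rewrite sumr_ge0// => i _; rewrite sumr_ge0.
Qed.

(** * Minimum of the scaled lattice *)

Section Minimum.
Variables (R : realType) (n : nat) (m : 'I_n -> nat) (beta : 'I_n -> R).
Variables (I : {set 'I_n}) (Q : 'I_n -> R) (G : set 'rV[R]_(\sum_i m i)).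
Hypothesis n0 : (0 < n)%N.
Hypothesis beta0 : forall i, 0 < beta i.
Hypothesis Q0 : forall i, 0 < Q i.
Hypothesis QI : forall i, i \notin I -> Q i <= Qbar beta Q.
Hypothesis latG : is_lattice G.
Hypothesis wadm : weakly_admissible beta I G.

Let t0 : 0 < total_weight beta.
Proof.
rewrite /total_weight (bigD1 (Ordinal n0))//= ltr_pwDl//.
by apply: sumr_ge0 => i _; exact: ltW.
Qed.

Lemma Qbar_gt0 : 0 < Qbar beta Q.
Proof. by rewrite powR_gt0// prodr_gt0// => i _; rewrite powR_gt0. Qed.

Lemma Qmax_ge i : Q i <= Qmax Q. Proof. exact: le_bigmax. Qed.

Lemma Qmax_gt0 : 0 < Qmax Q.
Proof. exact: lt_le_trans (Q0 (Ordinal n0)) (Qmax_ge _). Qed.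

Let D := block_scale m (fun i => Qbar beta Q / Q i) : 'M[R]_(\sum_i m i).

(** Needed for [inv_mu] to mean 1/mu: at mu = 0 its value would be 0. *)
Lemma mu_gt0 : (0 < mu beta I G (Qmax Q))%E.
Proof.
rewrite lt_min wadm ?Qmax_gt0// andbT.
have [B [uB GE]] := latG; have [e e0 eB] := lattice_min_gt0 uB.
apply: (@lt_le_trans _ _ e%:E); first by rewrite lte_fin.
apply: le_ereal_inf_tmp => _ [x [[Gx _] /= x0] <-]; rewrite lee_fin.
move: Gx x0; rewrite GE => -[z _ <-] zN; apply: eB.
by apply: contra_not_neq zN => ->; rewrite /= map_mx0 mul0mx.
Qed.

(** With e = |x D|, each block satisfies |x_i| <= (e / Qbar) Q_i. In the weighted product the Q_i
    combine to Qbar^t, which cancels and leaves e^t. *)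
Lemma Nm_le (x : 'rV[R]_(\sum_i m i)) : 0 < enorm (x *m D) ->
  Nm beta x `^ (total_weight beta)^-1 <= enorm (x *m D).
Proof.
move=> e0; set e := enorm _ in e0 *.
have Qb0 := Qbar_gt0; have Qb0' := ltW Qb0; have Q0' i := ltW (Q0 i).
set a := e / Qbar beta Q.
have a0 : 0 < a by rewrite divr_gt0.
have a0' := ltW a0; have t0' := ltW t0.
have xi i : enorm (submxrow x i) <= a * Q i.
  have := enorm_submxrow_le (x *m D) i; rewrite submxrow_block_scale enormZ -/e.
  rewrite ger0_norm ?divr_ge0// => h.
  by rewrite /a mulrAC ler_pdivlMr// mulrC -ler_pdivrMr// mulrAC.
have NmQ : Nm beta x <= a `^ total_weight beta * \prod_i (Q i `^ beta i).
  apply: (@le_trans _ _ (\prod_i ((a * Q i) `^ beta i))).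
    apply: ler_prod => i _; rewrite powR_ge0/= ge0_ler_powR ?nnegrE ?enorm_ge0 ?(ltW (beta0 i))//.
    by rewrite mulr_ge0.
  under eq_bigr do rewrite powRM ?(ltW a0) ?(ltW (Q0 _))//.
  rewrite big_split/= le_eqVlt; apply/orP; left; apply/eqP; congr (_ * _).
  rewrite /total_weight; elim/big_ind2: _ => [|u v w z -> ->|//]; first by rewrite powRr0.
  by rewrite powRD// (gt_eqF a0) implybT.
apply: (@le_trans _ _ ((a `^ total_weight beta * \prod_i (Q i `^ beta i)) `^ (total_weight beta)^-1)).
  rewrite ge0_ler_powR ?nnegrE ?invr_ge0//.
  - by apply: prodr_ge0 => i _; exact: powR_ge0.
  - by rewrite mulr_ge0 ?powR_ge0// prodr_ge0// => i _; exact: powR_ge0.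
rewrite powRM ?powR_ge0//; last by apply: prodr_ge0 => i _; exact: powR_ge0.
rewrite -powRrM divff ?gt_eqF// powRr1 ?(ltW a0)// -/(Qbar beta Q).
by rewrite /a divfK// gt_eqF.
Qed.

Lemma min_scaled_lattice (x : 'rV[R]_(\sum_i m i)) : G x -> x != 0 ->
  (inv_mu beta I G (Qmax Q) + (Qbar beta Q)^-1)^-1 <= enorm (x *m D).
Proof.
move=> Gx x0; set e := enorm _.
have Qb0 := Qbar_gt0; have Qb0' := ltW Qb0; have Q0' i := ltW (Q0 i).
have uD : D \in unitmx by apply: block_scale_unit => i; rewrite mulf_neq0 ?invr_neq0 ?gt_eqF.
have e0 : 0 < e.
  rewrite lt_neqAle enorm_ge0 andbT eq_sym; apply: contra_neq x0 => /enorm_eq0 xD.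
  by rewrite -(mulmxK uD x) xD mul0mx.
have mu0 := mu_gt0; rewrite /inv_mu; set mu' := mu _ _ _ _ in mu0 *.
have imu0 : 0 <= fine mu'^-1%E.
  by case: mu' mu0 => [r||]//=; rewrite fine_invr lte_fin invr_ge0 => /ltW.
have [Qe|eQ] := leP (Qbar beta Q) e.
  apply: le_trans Qe; rewrite -[leRHS]invrK lef_pV2 ?posrE ?invr_gt0 ?ltr_wpDl ?invr_gt0//.
  by rewrite lerDr.
have mue : (mu' <= e%:E)%E.
  rewrite /mu' /mu ge_min; apply/orP.
  have [xC|xC] := pselect (subspaceC I x).
    left; apply: (@le_trans _ _ (enorm x)%:E).
      by apply: ereal_inf_lbound; exists x => //; split=> //; apply/eqP.
    rewrite lee_fin; apply: le_enorm_blocks => i; rewrite submxrow_block_scale enormZ.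
    have [iI|iI] := boolP (i \in I).
      by rewrite (xC i iI) enorm0 mulr0.
    rewrite ler_peMl ?enorm_ge0// ger0_norm ?divr_ge0//.
    by rewrite ler_pdivlMr// mul1r QI.
  right; apply: (@le_trans _ _ (Nm beta x `^ (total_weight beta)^-1)%:E).
    apply: ereal_inf_lbound; exists x => //; split=> //=.
    apply: (@le_lt_trans _ _ (enorm ((Qmax Q / Qbar beta Q) *: (x *m D)))).
      apply: le_enorm_blocks => i.
      have -> : submxrow ((Qmax Q / Qbar beta Q) *: (x *m D)) i =
          (Qmax Q / Qbar beta Q) *: submxrow (x *m D) i.
        by apply/rowP => j; rewrite !mxE.
      rewrite submxrow_block_scale scalerA enormZ ler_peMl ?enorm_ge0//.
      rewrite mulrA divfK ?gt_eqF// ger0_norm ?divr_ge0 ?(ltW Qmax_gt0)//.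
      by rewrite ler_pdivlMr// mul1r Qmax_ge.
    rewrite enormZ -/e ger0_norm ?divr_ge0 ?(ltW Qmax_gt0)//.
    by rewrite -mulrA gtr_pMr ?Qmax_gt0// mulrC ltr_pdivrMr// mul1r.
  by rewrite lee_fin; exact: Nm_le.
case: mu' mu0 mue imu0 => [r||]//=; rewrite lte_fin lee_fin fine_invr => r0 re ir0.
apply: le_trans re; rewrite -[leRHS]invrK lef_pV2 ?posrE ?invr_gt0 ?ltr_wpDl ?invr_gt0//.
by rewrite lerDl invr_ge0 ltW.
Qed.
End Minimum.

Lemma le_Lip (R : realType) (D M : nat) (L L' : R) (S : set 'rV[R]_D) :
  L <= L' -> Lip M L S -> Lip M L' S.
Proof.
move=> LL [phi [phiL Sphi]]; exists phi; split=> // i x y xc yc.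
by apply: le_trans (phiL i x y xc yc) _; rewrite ler_wpM2r ?enorm_ge0.
Qed.

Lemma diam_le (R : realType) (d : nat) (S : set 'rV[R]_d) (c : R) : 0 <= c ->
  (forall x y, S x -> S y -> enorm (x - y) <= c) -> fine (diam S) <= c.
Proof.
move=> c0 Sc; have : (diam S <= c%:E)%E.
  apply: ge_ereal_sup => _ [->|[x Sx [y Sy <-]]]; rewrite lee_fin//.
  exact: Sc.
have : (0 <= diam S)%E by apply: ereal_sup_ubound; left.
by case: (diam S) => [r||]//=; rewrite lee_fin.
Qed.

Lemma fact_le_expn n : (n`! <= n ^ n)%N.
Proof.
elim: n => // n IH; rewrite factS expnS leq_mul2l /=.
by rewrite (leq_trans IH)//; case: n {IH} => // n; rewrite leq_exp2r.
Qed.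

(** * Bases and primitive points in coordinates *)

Section LatticeBasis.
Variables (R : realType) (d : nat) (G : set 'rV[R]_d) (B : 'M[R]_d).
Hypothesis BG : lattice_basis B G.

Lemma lattice_basis_change (U : 'M[int]_d) : U \in unitmx ->
  lattice_basis (map_mx intr U *m B) G.
Proof.
move=> uU; have [uB GE] := BG; split.
  by rewrite unitmx_mul uB andbT unitmxE det_map_mx rmorph_unit// -unitmxE.
rewrite GE; apply/seteqP; split=> _ [z _ <-].
  exists (z *m invmx U) => //.
  by rewrite mulmxA -map_mxM mulmxKV.
by exists (z *m U) => //; rewrite map_mxM mulmxA.
Qed.

Lemma lattice_pointE (x : 'rV[R]_d) : G x <-> exists z, x = zr R z *m B.
Proof.
have [_ ->] := BG; split=> [[z _ <-]|[z ->]]; first by exists z.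
by exists z.
Qed.

Lemma lattice_basis_inj : injective (fun z : 'rV[int]_d => zr R z *m B).
Proof.
move=> z z' /(can_inj (mulmxK BG.1)) zz; apply/eqP; rewrite -subr_eq0; apply/eqP.
by apply: (@zr_eq0 R); rewrite /zr map_mxB -!/(zr R _) zz subrr.
Qed.

Lemma primitiveE (z : 'rV[int]_d) : primitive G (zr R z *m B) <-> gcdv z = 1%N.
Proof.
have zrk (k : nat) (w : 'rV[int]_d) : zr R (k%:Z *: w) *m B = k%:R *: (zr R w *m B).
  by rewrite scalemxAl; congr (_ *m _); apply/rowP => j; rewrite !mxE intrM -pmulrn.
split=> [[_ pz]|gz].
  (* gcd 0 means the zero vector, which is twice itself and so not primitive. *)
  have [z0|] := posnP (gcdv z).
    have {}z0 : z = 0 by apply/eqP; rewrite -[_ == _]negbK -gcdv_gt0 z0.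
    case: pz; exists 2%N, 0; split=> //; last by rewrite z0 /zr map_mx0 mul0mx scaler0.
    by apply/lattice_pointE; exists 0; rewrite /zr map_mx0 mul0mx.
  rewrite leq_eqVlt => /orP[/eqP//|g1].
  have /dvdn_gcdvP[w zw] := dvdnn (gcdv z).
  case: pz; exists (gcdv z), (zr R w *m B); split=> //.
    by apply/lattice_pointE; exists w.
  by rewrite -zrk -zw.
split; first by apply/lattice_pointE; exists z.
move=> [k [_ [k1 /lattice_pointE[w ->] zE]]].
have {}zE : z = k%:Z *: w by apply: lattice_basis_inj; rewrite /= zrk.
have : (k %| gcdv z)%N by apply/dvdn_gcdvP; exists w.
by rewrite gz dvdn1 => /eqP kE; rewrite kE in k1.
Qed.
End LatticeBasis.

Theorem theorem2p3 (R : realType) (N M : nat) (kappa : R)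
    (hN : (1 < N)%N) (hM : (0 < M)%N) (hkappa : 0 < kappa) :
  exists c2 : R,
  forall (n : nat) (m : 'I_n -> nat) (beta : 'I_n -> R) (I : {set 'I_n})
    (Q : 'I_n -> R) (Lambda Z : set 'rV[R]_(\sum_i m i))
    (y : forall i, 'rV[R]_(m i)) (T : R -> R),
    (0 < n)%N ->
    (forall i, (0 < m i)%N) ->
    (\sum_i m i)%N = N ->
    (forall i, 0 < beta i) ->
    (forall i, 0 < Q i) ->
    (forall i, i \notin I -> Q i <= Qbar beta Q) ->
    is_lattice Lambda ->
    weakly_admissible beta I Lambda ->
    lip_family kappa M Z ->
    (forall x, Z x -> forall i, enorm (submxrow x i - y i) <= Q i) ->
    (forall u, 0 <= u -> 1 <= T u) ->
    (forall u v, 0 <= u -> u <= v -> T u <= T v) ->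
    (forall k : nat, (0 < k)%N -> (size (divisors k))%:R <= T k%:R) ->
    let Qb := Qbar beta Q in
    let imu := inv_mu beta I Lambda (Qmax Q) in
    let H := (N ^ (2 * N + 2))%:R * (Qb + enorm (phi_scale beta Q y))
             * (imu + Qb^-1) in
    (`| counting (Z `&` primitive Lambda)
        - vol Z / (zeta (N%:R : R) * lattice_det Lambda)%:E |
     <= (c2 * ((Qb * imu + 1) ^+ N.-1 + (Qb * imu + 1) * T H))%:E)%E.
Proof.
(* [r0 X] bounds the coordinates of the image of Z relative to its centre: N! comes from the reduced
   basis, and the factor N is a crude bound for the square root of n in |(x - Y) D| <= N Qbar.
   [L0 X] is kappa times the bound N (2 r0 X) for the diameter. *)
pose r0 : R := N`!%:R * N%:R.
pose L0 : R := kappa * (N%:R * (2 * r0)).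
exists (core_const N M L0 r0) => n m beta I Q Lambda Z y T n0 m0 NE beta0 Q0 QI.
move=> latL wadm lipZ Zy T1 Tle Tdiv; lazy zeta.
rewrite {}/L0 {}/r0; subst N; set d := (\sum_i m i)%N in hN *.
set Qb := Qbar beta Q; set imu := inv_mu beta I Lambda (Qmax Q).
set H := (d ^ _)%:R * _ * _.
set r0 : R := d`!%:R * d%:R; set L0 := kappa * _.
have Qb0 : 0 < Qb := Qbar_gt0 beta Q0.
(* The very basis chosen in [lattice_det], so that the determinants can be compared. *)
pose B0 : 'M[R]_d := get [set B : 'M[R]_d | lattice_basis B Lambda].
have LB0 : lattice_basis B0 Lambda.
  case: latL => B LB; exact: (@getI _ [set B : 'M[R]_d | lattice_basis B Lambda] B LB).
have [uB0 _] := LB0.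
pose D : 'M[R]_d := block_scale m (fun i => Qb / Q i).
pose lam : R := (imu + Qb^-1)^-1.
have imu0 : 0 <= imu.
  rewrite /imu /inv_mu; have := mu_gt0 n0 Q0 latL wadm.
  by case: (mu _ _ _ _) => [r||]//=; rewrite fine_invr lte_fin invr_ge0 => /ltW.
have iQ0 : 0 < imu + Qb^-1 by rewrite ltr_wpDl// invr_gt0.
have lam0 : 0 < lam by rewrite invr_gt0.
have Bmin (z : 'rV[int]_d) : z != 0 -> lam <= enorm (zr R z *m (B0 *m D)).
  move=> zN; rewrite mulmxA; apply: min_scaled_lattice => //.
    by apply/(lattice_pointE LB0); exists z.
  apply: contra_neq zN => zB; apply: (@zr_eq0 R).
  by rewrite -(mulmxK uB0 (zr R z)) zB mul0mx.
have [U uU redU] := reduced_basis lam0 Bmin.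
(* [E] is a basis of Lambda itself, not of its scaled image: [D] occurs only in the estimates, while
   the inverse [A] takes Lambda to Z^d. *)
pose E : 'M[R]_d := map_mx intr U *m B0.
have LE : lattice_basis E Lambda := lattice_basis_change LB0 uU.
have uE : E \in unitmx := LE.1.
pose A := invmx E.
have uA : A \in unitmx by rewrite unitmx_inv.
have coordA (x : 'rV[R]_d) j : `|(x *m A) 0 j| * lam <= d`!%:R * enorm (x *m D).
  have := redU (x *m A) j.
  by rewrite -mulmxA (mulmxA _ B0) -/E mulmxA mulmxKV.
pose X := Qb * imu + 1.
have XE : X = Qb * (imu + Qb^-1) by rewrite /X mulrDr mulfV ?gt_eqF.
have X1 : 1 <= X by rewrite /X lerDr mulr_ge0// ltW.
have X0 : 0 <= X by apply: le_trans X1.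
pose Y : 'rV[R]_d := \mxrow_i y i.
have YD : Y *m D = phi_scale beta Q y.
  by apply/mxrowP => i; rewrite submxrow_block_scale !mxrowK.
have nd : (n <= d)%N.
  rewrite -[n]card_ord -sum1_card; apply: leq_sum => i _; exact: m0.
have ZYD (x : 'rV[R]_d) : Z x -> enorm ((x - Y) *m D) <= d%:R * Qb.
  move=> Zx; rewrite -(@ler_pXn2r _ 2)// ?nnegrE ?enorm_ge0 ?mulr_ge0 ?(ltW Qb0)//.
  rewrite enorm_blocks; apply: (@le_trans _ _ (\sum_(i < n) Qb ^+ 2)).
    apply: ler_sum => i _; rewrite submxrow_block_scale enormZ submxrowB mxrowK.
    rewrite lerXn2r ?nnegrE ?mulr_ge0 ?enorm_ge0 ?(ltW Qb0)//.
    rewrite ger0_norm ?divr_ge0 ?(ltW Qb0) ?(ltW (Q0 i))//.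
    by rewrite mulrAC ler_pdivrMr// ler_wpM2l ?(ltW Qb0)// Zy.
  rewrite sumr_const card_ord -[leLHS]mulr_natl exprMn ler_wpM2r ?sqr_ge0//.
  by rewrite -natrX ler_nat (leq_trans nd)// expnS expn1 leq_pmull// (ltnW hN).
have diffA (c : 'rV[R]_d) (j : 'I_d) : Z c -> `|(c *m A) 0 j - (Y *m A) 0 j| <= r0 * X.
  move: c j => x j Zx; have -> : (x *m A) 0 j - (Y *m A) 0 j = ((x - Y) *m A) 0 j.
    by rewrite mulmxBl !mxE.
  have := coordA (x - Y) j; rewrite -ler_pdivlMr// /lam invrK => /le_trans; apply.
  by rewrite XE mulrA ler_wpM2r ?(ltW iQ0)// -mulrA ler_wpM2l// ZYD.
pose W := [set x *m A | x in Z].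
have r00 : 0 <= r0 by rewrite mulr_ge0.
have L00 : 0 <= L0 by rewrite !mulr_ge0 ?(ltW hkappa).
have d0 : (0 < d)%N := ltnW hN.
have WY c : W c -> forall j, `|c 0 j - (Y *m A) 0 j| <= r0 * X.
  by move=> [x Zx <-] j; exact: diffA.
have phi0 := enorm_ge0 (phi_scale beta Q y).
have Qphi : 0 <= Qb + enorm (phi_scale beta Q y) by rewrite addr_ge0// ltW.
have XH : X <= H.
  rewrite XE /H ler_wpM2r ?(ltW iQ0)//.
  apply: (@le_trans _ _ (Qb + enorm (phi_scale beta Q y))); first by rewrite lerDl.
  by rewrite ler_peMl// (ler_nat R 1) expn_gt0 d0.
have WH c : W c -> forall j, `|c 0 j| <= H.
  move=> Wc j; have h1 := WY c Wc j.
  have h2 : `|(Y *m A) 0 j| <= d`!%:R * enorm (phi_scale beta Q y) * (imu + Qb^-1).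
    by have := coordA Y j; rewrite -ler_pdivlMr// /lam invrK YD.
  have -> : c 0 j = (c 0 j - (Y *m A) 0 j) + (Y *m A) 0 j by rewrite subrK.
  apply: le_trans (ler_normD _ _) _; apply: le_trans (lerD h1 h2) _.
  rewrite XE mulrA -mulrDl /H ler_wpM2r ?(ltW iQ0)//.
  apply: (@le_trans _ _ (r0 * (Qb + enorm (phi_scale beta Q y)))).
    rewrite mulrDr lerD2l ler_wpM2r// /r0 ler_peMr// (ler_nat R 1).
    exact: d0.
  (* Origin of the power in H: d! d <= d^(d+1) <= d^(2d+2). *)
  rewrite ler_wpM2r// /r0 -natrM ler_nat.
  apply: (@leq_trans (d ^ d * d)); first by rewrite leq_mul2r fact_le_expn orbT.
  by rewrite -expnSr leq_pexp2l// -addn1 leq_add// leq_pmull.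
have LipW (k : nat) : (0 < k)%N -> Lip M (L0 * X / k%:R) (bdry [set k%:R^-1 *: x | x in W]).
  move=> k0; have k0' : 0 < k%:R :> R by rewrite ltr0n.
  have uAk : k%:R^-1 *: A \in unitmx.
    by rewrite unitmxZ// unitfE invr_neq0// gt_eqF.
  have [_] := lipZ _ uAk.
  have -> : [set x *m (k%:R^-1 *: A) | x in Z] = [set k%:R^-1 *: x | x in W].
    apply/seteqP; split=> [_ [x Zx <-]|_ [_ [x Zx <-] <-]].
      by exists (x *m A); [exists x|rewrite scalemxAr].
    by exists x => //; rewrite scalemxAr.
  have q0 : 0 <= 2 * (r0 * X / k%:R) by rewrite !mulr_ge0 ?invr_ge0 ?(ltW k0').
  apply: le_Lip; have -> : L0 * X / k%:R = kappa * (d%:R * (2 * (r0 * X / k%:R))).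
    have alg (a b c e f : R) : a * (b * (2 * c)) * e * f = a * (b * (2 * (c * e * f))) by ring.
    exact: alg.
  rewrite ler_wpM2l ?(ltW hkappa)//.
  apply: diam_le => [|_ _ [u Wu <-] [v Wv <-]]; first exact: mulr_ge0.
  apply: enorm_le => // j; rewrite -scalerBr !mxE normrM.
  rewrite ger0_norm ?invr_ge0 ?(ltW k0')//.
  have alg (a b : R) : 2 * (a * b) = b * (2 * a) by ring.
  rewrite alg ler_wpM2l ?invr_ge0 ?(ltW k0')//.
  have := WY u Wu j; have := WY v Wv j; rewrite !ler_norml => /andP[a1 a2] /andP[b1 b2].
  by apply/andP; split; lra.
pose s := [seq z <- int_cube d (Num.truncn H) | `[< W (zr R z) >] && (gcdv z == 1%N)].
have us : uniq s by rewrite filter_uniq// int_cube_uniq.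
have sP z : z \in s <-> W (zr R z) /\ gcdv z = 1%N.
  rewrite mem_filter; split=> [/andP[/andP[/asboolP ? /eqP ?]]|[Wz ->]] //.
  rewrite asboolT//= (@mem_int_cube _ R _ _ H) ?truncnS_gt// => j.
  by have := WH _ Wz j; rewrite mxE.
have main := primitive_count hN L00 r00 X1 XH WY WH LipW T1 Tle Tdiv us sP.
have WE (z : 'rV[int]_d) : W (zr R z) <-> Z (zr R z *m E).
  split=> [[x Zx xz]|Zz]; first by rewrite -xz mulmxKV.
  by exists (zr R z *m E) => //; rewrite mulmxK.
have -> : counting (Z `&` primitive Lambda) = (size s)%:R%:E :> \bar R.
  rewrite -(size_map (fun z => zr R z *m E)) -counting_seq; last first.
    by rewrite map_inj_uniq//; exact: lattice_basis_inj LE.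
  congr counting; apply/seteqP; split=> [x [Zx px]|_ /= /mapP[z /sP[Wz gz] ->]].
    have /(lattice_pointE LE)[z xz] := px.1; apply/mapP; exists z => //.
    by apply/sP; split; [apply/WE|apply: (primitiveE LE z).1]; rewrite -xz.
  by split; [exact/WE|apply: (primitiveE LE z).2].
have dE : `|\det E| = lattice_det Lambda.
  rewrite /E det_mulmx normrM det_map_mx -intr_norm /lattice_det -/B0.
  suff -> : `|\det U| = 1 by rewrite mul1r.
  by move: uU; rewrite unitmxE => /orP[/eqP -> | /eqP ->]; rewrite ?normrN normr1.
have ld0 : 0 < lattice_det Lambda by rewrite -dE normr_gt0 -unitfE -unitmxE.
have volW : vol W = ((lattice_det Lambda)^-1%:E * vol Z)%E.
  by rewrite /W vol_mulmx// /A det_inv normfV dE.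
have fW : vol W \is a fin_num := fin_vol_boxed hN r00 X1 WY.
have volZ : vol Z = (lattice_det Lambda * fine (vol W))%:E.
  by rewrite EFinM fineK// volW muleA -EFinM mulfV ?gt_eqF// mul1e.
(* Together with the positive determinant this makes the division in the extended reals an ordinary
   one. *)
have z1 : 0 < zeta (d%:R : R).
  have /andP[+ _] := zeta_bounds R hN (ltnSn 0).
  by apply: lt_le_trans; rewrite /zeta_sum big_nat1 expr1n invr1.
rewrite volZ inver mulf_eq0 !gt_eqF//= lee_fin -/X.
move: main; congr (`|_ - _| <= _).
by field; rewrite !gt_eqF.
Qed.
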